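(* For every $p$ with $1<p<2$ there is a constant $K_p>0$, depending only on $p$, such that for every canonical product $\Pi(z)$ of genus one, $$ \int_0^\infty\frac{\log M(r,\Pi)}{r^{p+1}}\,dr\le K_p\left(\gamma_p(\Pi)+\alpha_p(\Pi^{-1})\right). $$
   Context: A canonical product of genus one is an entire function $\Pi(z)=\prod_k E(z/z_k)$, where $E(z)=(1-z)e^z$ and $\{z_k\}$ is a (finite or infinite) sequence of nonzero complex numbers with $\sum_k|z_k|^{-2}<\infty$; the $z_k$ are the zeros of $\Pi$, listed with multiplicity. $M(r,\Pi)=\max_{|z|=r}|\Pi(z)|$; $$\gamma_p(\Pi)=\sum_k\left|\mathrm{Im}\frac1{z_k}\right|^p,\qquad \alpha_p(\Pi^{-1})=\frac1\pi\int_{-\infty}^{\infty}\frac{\log^-|\Pi(t)|}{|t|^{p+1}}\,dt,$$ where $\log^-x=\max(-\log x,0)$. These quantities are allowed to equal $+\infty$. *)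

(* Defs.v *)
From HB Require Import structures.
From mathcomp Require Import all_boot all_order all_algebra.
From mathcomp Require Import complex.
From mathcomp Require Import all_classical all_reals all_analysis.

Set Implicit Arguments.
Unset Strict Implicit.
Unset Printing Implicit Defensive.

Import Order.TTheory GRing.Theory Num.Theory.
Import numFieldNormedType.Exports.

Local Open Scope classical_set_scope.
Local Open Scope ring_scope.
Local Open Scope complex_scope.

Definition cmod (R : realType) (w : R[i]) : R := Normc.normc w.

Definition cexp (R : realType) (w : R[i]) : R[i] :=
  (expR (complex.Re w) * cos (complex.Im w)) +i*
  (expR (complex.Re w) * sin (complex.Im w)).

Definition E1 (R : realType) (w : R[i]) : R[i] := (1 - w) * cexp w.

(* A finite or infinite sequence of complex numbers is given by a length
   N : option nat, None standing for an infinite sequence, and z : nat -> R[i];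
   only the values z k with in_range N k are terms of the sequence. *)
Definition in_range (N : option nat) (k : nat) : bool :=
  if N is Some n then (k < n)%N else true.

Definition genus1_zeros (R : realType) (N : option nat) (z : nat -> R[i]) :
    Prop :=
  (forall k, in_range N k -> z k != 0) /\
  (\sum_(k <oo | in_range N k) ((cmod (z k)) ^- 2)%:E < +oo)%E.

(* The alias R[i]^o carries the topology of R[i] given by its norm. *)
Definition canonical_product (R : realType) (N : option nat)
    (z : nat -> R[i]) (w : R[i]) : R[i] :=
  lim ((fun n : nat =>
          \prod_(0 <= k < n | in_range N k) E1 (w / z k) : (R[i])^o) @ \oo).

(* For f continuous and 0 <= r, the supremum is a maximum over a nonempty
   compact circle. *)
Definition max_modulus (R : realType) (r : R) (f : R[i] -> R[i]) : R :=
  sup [set cmod (f w) | w in [set w : R[i] | cmod w = r]].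

Definition gamma (R : realType) (p : R) (N : option nat) (z : nat -> R[i]) :
    \bar R :=
  (\sum_(k <oo | in_range N k) (`|complex.Im (z k)^-1| `^ p)%:E)%E.

(* Extended-real valued, so that log_minus 0 = +oo. *)
Definition log_minus (R : realType) (x : R) : \bar R :=
  maxe (- lne x%:E)%E 0%E.

(* [alpha_inv p f] is alpha_p(1/f); the integrand is stated in terms of f, as
   log^+ |1/f| = log^- |f|. *)
Definition alpha_inv (R : realType) (p : R) (f : R[i] -> R[i]) : \bar R :=
  ((pi^-1)%:E *
   \int[@lebesgue_measure R]_(t in [set: R])
     (log_minus (cmod (f t%:C)) * ((`|t| `^ (p + 1))^-1)%:E))%E.

(* Main.v *)
(* Write c_k = 1/z_k = a_k + i b_k.  Since log|E(w)| <= 2 min(|w|, |w|^2), the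
   left-hand side is at most C_p sum |c_k|^p, and it remains to bound
   sum |a_k|^p by sum |b_k|^p and alpha_p.  Integrate -log|Pi| over the real
   line against K_tau(t) = k(t/tau)/tau, where k >= 0 is the derivative of
   -1/(t(1+t^2)).  A factor with c = a + ib contributes
     pi ((tau a)^2 (1-B) - B^2 (1+B)) / ((1+B)^2 + (tau a)^2),   B = tau |b|,
   which is at least a multiple of (tau a)^2/(1+(tau a)^2) minus a multiple of
   min(B, B^2).  As K_tau(t) = O(t^-4) at infinity, the tail of the product over
   k >= n only costs O(tau^2 sum_{k>=n} |c_k|^2), which
   tends to 0 for fixed tau: convergence of sum |a_k|^p is not presupposed.
   Integrating the resulting inequality against tau^(-p-1) turns the three terms
   into sum |a_k|^p, sum |b_k|^p and the integral defining alpha_p. *)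

Require Import Defs.
From HB Require Import structures.
From mathcomp Require Import all_boot all_order all_algebra.
From mathcomp Require Import complex.
From mathcomp Require Import all_classical all_reals all_analysis.
From mathcomp Require Import measurable_realfun.
From mathcomp Require Import ring lra.

Set Implicit Arguments.
Unset Strict Implicit.
Unset Printing Implicit Defensive.

Import Order.TTheory GRing.Theory Num.Theory.
Import numFieldNormedType.Exports.

Local Open Scope classical_set_scope.
Local Open Scope ring_scope.

(** Why this kernel: for c = a + ib, log|E(tc)| = log|1 - tc| + ta is O(t^2) at 0, so a double pole
    there is harmless. The kernel is even, so folding t onto -t cancels ta and leaves log|1 - t^2
    c^2|. Its primitive is rational, so integration by parts gives elementary integrals. For real
    nonzero c the outcome is pi (tau a)^2 / (1 + (tau a)^2) > 0, which is how log^- detects real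
    parts. Both M(r) and log^- are handled through upper bounds for |Pi| alone. Such bounds pass to
    the limit of the partial products, and hold also for the default value 0 of [lim]; they allow
    |b| to be enlarged, and they let log^-|Pi| be replaced by a measurable minorant before Tonelli's
    theorem is applied. The range 1 < p < 2 is the one where min(x, x^2) x^(-p-1) is integrable on
    the half-line. A bound of this shape controls the growth of a factor, the loss due to b, and the
    kernel as a function of tau. *)

Section RealDerivatives.
Variable R : realType.
Implicit Types (f g : R -> R) (x df dg : R).

(** The rules of this section have explicit [fun t =>] bodies and ordinary products, so that the
    derivative of a long expression is built as a single term and only its value is left to [field]
    or [ring]. *)
Lemma is_derive_cstl (k : R) x : is_derive x 1 (fun=> k) 0.
Proof. exact: is_derive_cst. Qed.

Lemma is_derive_idl x : is_derive x 1 (fun t : R => t) 1.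
Proof. exact: is_derive_id. Qed.

Lemma is_deriveDl f g x df dg : is_derive x 1 f df -> is_derive x 1 g dg ->
  is_derive x 1 (fun t => f t + g t) (df + dg).
Proof. exact: is_deriveD. Qed.

Lemma is_derive_suml n (h : 'I_n -> R -> R) (dh : 'I_n -> R) x :
  (forall k, is_derive x 1 (h k) (dh k)) ->
  is_derive x 1 (fun t => \sum_(k < n) h k t) (\sum_(k < n) dh k).
Proof.
move=> Dh; have := is_derive_sum Dh.
by rewrite (_ : \sum_(k < n) h k = fun t => \sum_(k < n) h k t)//;
  apply/funext => t; rewrite fct_sumE.
Qed.

Lemma is_deriveNl f x df : is_derive x 1 f df ->
  is_derive x 1 (fun t => - f t) (- df).
Proof. exact: is_deriveN. Qed.

Lemma is_deriveMl f g x df dg : is_derive x 1 f df -> is_derive x 1 g dg ->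
  is_derive x 1 (fun t => f t * g t) (f x * dg + df * g x).
Proof.
move=> Df Dg; apply: is_derive_eq (is_deriveM Df Dg) _.
by rewrite /GRing.scale/= [df * _]mulrC.
Qed.

Lemma is_deriveVl f x df : f x != 0 -> is_derive x 1 f df ->
  is_derive x 1 (fun t => (f t)^-1) (- (df / f x ^+ 2)).
Proof.
move=> f0 Df; apply: is_derive_eq (is_deriveV f0 Df) _.
by rewrite /GRing.scale/= mulNr mulrC.
Qed.

Lemma is_derive_lnl f x df : 0 < f x -> is_derive x 1 f df ->
  is_derive x 1 (fun t => ln (f t)) (df / f x).
Proof.
move=> f0 Df; apply: is_derive_eq (is_derive1_comp (is_derive1_ln f0) Df) _.
exact: mulrC.
Qed.

Lemma is_derive_atanl f x df : is_derive x 1 f df ->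
  is_derive x 1 (fun t => atan (f t)) (df / (1 + f x ^+ 2)).
Proof.
move=> Df; apply: is_derive_eq (is_derive1_comp (is_derive1_atan _) Df) _.
exact: mulrC.
Qed.

Lemma is_derive_continuous f x df : is_derive x 1 f df -> {for x, continuous f}.
Proof.
move=> Df; apply: differentiable_continuous; apply/derivable1_diffP.
exact: (@ex_derive _ _ _ _ _ _ _ Df).
Qed.

End RealDerivatives.

(** * The kernel and its primitive against [log|1 - t^2 c^2|] *)

Section LogKernel.
Variable R : realType.
Implicit Types (a b t x : R).

(* [|1 - tc|^2] for [c = a + ib]. *)
Definition quad a b t : R := (1 - t * a) ^+ 2 + (t * b) ^+ 2.

(* The derivative of [- 1 / (t (1 + t^2))]; at [t = 0] the division gives [0]. *)
Definition kern t : R := (3 * t ^+ 2 + 1) / (t * (1 + t ^+ 2)) ^+ 2.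

Lemma quad_gt0 a b t : b != 0 -> 0 < quad a b t.
Proof.
move=> b0; rewrite /quad; have [->|t0] := eqVneq t 0.
  by rewrite !mul0r subr0 expr0n addr0 expr1n.
by rewrite ltr_wpDl ?sqr_ge0// exprn_even_gt0//= mulf_neq0.
Qed.

Lemma quadN a b t : quad a b (- t) = quad (- a) b t.
Proof. by rewrite /quad; ring. Qed.

Lemma quad0 a b : quad a b 0 = 1.
Proof. by rewrite /quad; ring. Qed.

Lemma is_derive_quad a b t :
  is_derive t 1 (quad a b) (2 * (t * (a ^+ 2 + b ^+ 2) - a)).
Proof.
rewrite /quad.
have Dl (u v : R) : is_derive t 1 (fun t : R => u + t * v) v.
  apply: is_derive_eq (is_deriveDl (is_derive_cstl _ _)
    (is_deriveMl (is_derive_idl _) (is_derive_cstl _ _))) _; ring.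
have -> : (fun t => (1 - t * a) ^+ 2 + (t * b) ^+ 2) =
  (fun t => (1 + t * - a) * (1 + t * - a) + (0 + t * b) * (0 + t * b)).
  by apply/funext => s; ring.
apply: is_derive_eq (is_deriveDl (is_deriveMl (Dl _ _) (Dl _ _))
  (is_deriveMl (Dl _ _) (Dl _ _))) _; ring.
Qed.

(** The quotient [b / quad a b t] is the imaginary part of c/(1 - tc); completing the square in
    [quad] turns it into the derivative of an arctangent. *)
Lemma is_derive_atan_quad a b t : b != 0 ->
  is_derive t 1 (fun t => atan ((t * (a ^+ 2 + b ^+ 2) - a) / b))
    (b / quad a b t).
Proof.
move=> b0.
have N0 : a ^+ 2 + b ^+ 2 != 0.
  by rewrite gt_eqF// ltr_wpDl ?sqr_ge0// exprn_even_gt0.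
apply: is_derive_eq (is_derive_atanl (is_deriveMl (is_deriveDl (is_deriveMl
  (is_derive_idl _) (is_derive_cstl _ _)) (is_derive_cstl _ _))
  (is_derive_cstl _ _))) _ => /=.
have q0 := quad_gt0 a t b0.
have -> : 1 + ((t * (a ^+ 2 + b ^+ 2) - a) / b) ^+ 2 =
  (a ^+ 2 + b ^+ 2) / b ^+ 2 * quad a b t by rewrite /quad; field.
field; rewrite b0 (gt_eqF q0) N0//.
Qed.

(** This is |1 + c^2|^2, factored as |1 - ic|^2 |1 + ic|^2. For b > 0 it vanishes only at c = i,
    whence the side condition [(a != 0) || (b != 1)]. *)
Definition mu_den a b : R :=
  ((1 + b) ^+ 2 + a ^+ 2) * ((1 - b) ^+ 2 + a ^+ 2).

Lemma mu_den_factors_neq0 a b : 0 < b -> (a != 0) || (b != 1) ->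
  (1 + b) ^+ 2 + a ^+ 2 != 0 /\ (1 - b) ^+ 2 + a ^+ 2 != 0.
Proof.
move=> b_gt0 ab; split.
  by rewrite gt_eqF// ltr_wpDr ?sqr_ge0// exprn_even_gt0//= gt_eqF// addr_gt0.
rewrite paddr_eq0 ?sqr_ge0// !sqrf_eq0 subr_eq0 [1 == b]eq_sym.
by rewrite negb_and orbC.
Qed.

Definition mu_re a b : R :=
  (a ^+ 2 - b ^+ 2 + (a ^+ 2 + b ^+ 2) ^+ 2) / mu_den a b.

Definition mu_im a b : R := 2 * a * b / mu_den a b.

(* With [c = a + ib] and [mu = c^2/(1+c^2)], the four summands are the boundary
   term [- log|1-t^2c^2| / (t(1+t^2))] and the real part of a primitive of
   [-2 (mu c / 2) (c/(1-tc) + c/(1+tc)) - 2 mu/(1+t^2)]. *)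
Definition prim a b t : R :=
  - ((ln (quad a b t) + ln (quad (- a) b t)) / 2) / (t * (1 + t ^+ 2))
  + (a * mu_re a b - b * mu_im a b) * ((ln (quad a b t) - ln (quad (- a) b t)) / 2)
  + (a * mu_im a b + b * mu_re a b) *
      (atan ((t * (a ^+ 2 + b ^+ 2) - a) / b) + atan ((t * (a ^+ 2 + b ^+ 2) + a) / b))
  - 2 * mu_re a b * atan t.

Lemma is_derive_prim a b t : 0 < b -> (a != 0) || (b != 1) -> 0 < t ->
  is_derive t 1 (prim a b)
    ((ln (quad a b t) + ln (quad (- a) b t)) / 2 * kern t).
Proof.
move=> b_gt0 ab t0; have b0 : b != 0 by rewrite gt_eqF.
have [D1 D2] := mu_den_factors_neq0 b_gt0 ab.
have q1 := quad_gt0 a t b0.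
have q2 := quad_gt0 (- a) t b0.
have t2 : t * (1 + t ^+ 2) != 0.
  by rewrite mulf_neq0 ?gt_eqF// ltr_pwDl// sqr_ge0.
have L1 := is_derive_lnl q1 (is_derive_quad a b t).
have L2 := is_derive_lnl q2 (is_derive_quad (- a) b t).
have A1 := is_derive_atan_quad a t b0.
have A2 := is_derive_atan_quad (- a) t b0.
rewrite /= !(sqrrN, opprK) in L1 L2 A1 A2.
have P : is_derive t 1 (fun t : R => t * (1 + t ^+ 2)) (1 + 3 * t ^+ 2).
  apply: is_derive_eq (is_deriveMl (is_derive_idl _) (is_deriveDl
    (is_derive_cstl _ _)
    (is_deriveMl (is_derive_idl _) (is_derive_idl _)))) _; ring.
have C (k : R) := is_derive_cstl k t.
rewrite /prim.
apply: is_derive_eq (is_deriveDl (is_deriveDl (is_deriveDl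
  (is_deriveMl (is_deriveNl (is_deriveMl (is_deriveDl L1 L2) (C _)))
  (@is_deriveVl R (fun t => t * (1 + t ^+ 2)) _ _ t2 P))
  (is_deriveMl (C _) (is_deriveMl (is_deriveDl L1 (is_deriveNl L2)) (C _))))
  (is_deriveMl (C _) (is_deriveDl A1 A2)))
  (is_deriveNl (is_deriveMl (C _) (is_derive_atanl (is_derive_idl t))))) _.
rewrite /kern /mu_re /mu_im /mu_den /=.
move: (ln (quad a b t)) (ln (quad (- a) b t)) => l1 l2.
have q1E : quad a b t != 0 by rewrite gt_eqF.
have q2E : quad (- a) b t != 0 by rewrite gt_eqF.
have t0' : t != 0 by rewrite gt_eqF.
have t1' : 1 + t ^+ 2 != 0 by rewrite gt_eqF// ltr_pwDl// sqr_ge0.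
rewrite /quad in q1E q2E *.
by field; rewrite q1E q2E t0' t1' D1 D2.
Qed.

Definition prim_lim a b : R :=
  pi * (a * mu_im a b + b * mu_re a b - mu_re a b).

(** The factor of [mu_den] that vanishes at c = i cancels, which leaves a quotient regular for all b
    > 0. *)
Lemma prim_limE a b : 0 < b -> (a != 0) || (b != 1) ->
  prim_lim a b = - pi * ((a ^+ 2 * (1 - b) - b ^+ 2 * (1 + b)) /
                         ((1 + b) ^+ 2 + a ^+ 2)).
Proof.
move=> b_gt0 ab.
have [D1 D2] := mu_den_factors_neq0 b_gt0 ab.
by rewrite /prim_lim /mu_re /mu_im /mu_den; field; rewrite D1 D2.
Qed.

(** The boundary terms are favourable: at a large T the logarithms are nonnegative, and at 1/T the
    bound ln(1 + x) <= x leaves at most N/T. What remains is a function [G1] of 1/T, continuous and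
    zero at 0, plus arctangents that tend to pi/2. *)
Lemma prim_le_lim a b (e : R) : 0 < b -> 0 < e ->
  \forall T \near +oo, prim a b T - prim a b T^-1 <= prim_lim a b + e.
Proof.
move=> b_gt0 e0; have b0 : b != 0 by rewrite gt_eqF.
pose N := a ^+ 2 + b ^+ 2.
have N0 : 0 < N by rewrite ltr_wpDl ?sqr_ge0// exprn_even_gt0.
pose mr := mu_re a b; pose mi := mu_im a b.
pose rho := a * mr - b * mi; pose sig := a * mi + b * mr.
(* For s != 0 this is s^2 [quad c b (1/s)]; it rewrites the difference of logarithms at T as a
   function of s = 1/T that is regular at s = 0. *)
pose q2 c s := (s - c) ^+ 2 + b ^+ 2.
have q2_gt0 c s : 0 < q2 c s.
  by rewrite /q2 ltr_wpDl ?sqr_ge0// exprn_even_gt0.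
pose G1 s := N * s + rho / 2 * (ln (q2 a s) - ln (q2 (- a) s))
   - rho / 2 * (ln (quad a b s) - ln (quad (- a) b s))
   - sig * (atan ((s * N - a) / b) + atan ((s * N + a) / b))
   + 2 * mr * atan s.
have G10 : G1 0 = 0.
  rewrite /G1 /q2 !quad0 !sub0r !(sqrrN, opprK) !mul0r !sub0r add0r mulNr atanN atan0.
  by rewrite addNr !subrr !mulr0; ring.
have cG1 : {for 0, continuous G1}.
  have C (k : R) := is_derive_cstl k 0.
  have I := is_derive_idl (0 : R).
  have Q2 c : is_derive (0 : R) 1 (q2 c) (2 * (0 - c)).
    have Dl : is_derive (0 : R) 1 (fun t : R => t - c) (1 : R).
      by apply: is_derive_eq (is_deriveDl I (is_deriveNl (C c))) _; ring.
    by apply: is_derive_eq (is_deriveDl (is_deriveMl Dl Dl) (C _)) _; ring.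
  have Q c := is_derive_quad c b 0.
  have A1 := is_derive_atan_quad a 0 b0.
  have A2 := is_derive_atan_quad (- a) 0 b0.
  rewrite /= !(sqrrN, opprK) -/N in A1 A2.
  exact: is_derive_continuous (is_deriveDl (is_deriveDl (is_deriveDl (is_deriveDl
    (is_deriveMl (C N) I)
    (is_deriveMl (C (rho / 2)) (is_deriveDl (is_derive_lnl (q2_gt0 _ _) (Q2 a))
      (is_deriveNl (is_derive_lnl (q2_gt0 _ _) (Q2 (- a)))))))
    (is_deriveNl (is_deriveMl (C (rho / 2)) (is_deriveDl
       (is_derive_lnl (quad_gt0 _ _ b0) (Q a))
      (is_deriveNl (is_derive_lnl (quad_gt0 _ _ b0) (Q (- a))))))))
    (is_deriveNl (is_deriveMl (C sig) (is_deriveDl A1 A2))))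
    (is_deriveMl (C (2 * mr)) (is_derive_atanl I))).
pose G T := G1 T^-1
  + sig * (atan ((T * N - a) / b) + atan ((T * N + a) / b)) - 2 * mr * atan T.
have GE T : 0 < T -> 2 * `|a| / N < T -> prim a b T - prim a b T^-1 <= G T.
  move=> T0 Ta.
  have qE c : quad c b T = T ^+ 2 * q2 c T^-1.
    by rewrite /quad /q2; field; rewrite gt_eqF.
  have l2 : ln (quad a b T) - ln (quad (- a) b T) = ln (q2 a T^-1) - ln (q2 (- a) T^-1).
    rewrite !qE !lnM ?posrE ?exprn_gt0//; ring.
  have b1 c : `|c| = `|a| -> 0 <= ln (quad c b T).
    move=> ca; rewrite ln_ge0//.
    have -> : quad c b T = 1 + T * (T * (c ^+ 2 + b ^+ 2) - 2 * c).
      by rewrite /quad; ring.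
    rewrite lerDl mulr_ge0 ?(ltW T0)// subr_ge0.
    rewrite -(real_normK (num_real c)) ca (real_normK (num_real a)) -/N.
    rewrite (le_trans _ (_ : 2 * `|a| <= _)) ?ler_pM2l//.
      by rewrite -ca ler_norm.
    by rewrite -ler_pdivrMr// ltW.
  have b2 c : ln (quad c b T^-1) <= T^-1 ^+ 2 * (c ^+ 2 + b ^+ 2) - 2 * T^-1 * c.
    have -> : quad c b T^-1 =
      1 + (T^-1 ^+ 2 * (c ^+ 2 + b ^+ 2) - 2 * T^-1 * c).
      by rewrite /quad; ring.
    apply: le_ln1Dx; rewrite -subr_gt0.
    have -> : T^-1 ^+ 2 * (c ^+ 2 + b ^+ 2) - 2 * T^-1 * c - -1 =
      quad c b T^-1 by rewrite /quad; ring.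
    exact: quad_gt0.
  rewrite /prim -/N -/mr -/mi -/rho -/sig l2 /G /G1.
  have s0 : 0 < T^-1 by rewrite invr_gt0.
  have d1 : 0 < T * (1 + T ^+ 2) by rewrite mulr_gt0// ltr_pwDl// sqr_ge0.
  have d2 : 0 < T^-1 * (1 + T^-1 ^+ 2) by rewrite mulr_gt0// ltr_pwDl// sqr_ge0.
  have e1 : - ((ln (quad a b T) + ln (quad (- a) b T)) / 2) / (T * (1 + T ^+ 2)) <= 0.
    by rewrite mulNr oppr_le0 divr_ge0 ?(ltW d1)// divr_ge0// addr_ge0// b1// normrN.
  have e2 : (ln (quad a b T^-1) + ln (quad (- a) b T^-1)) / 2 /
      (T^-1 * (1 + T^-1 ^+ 2)) <= N * T^-1.
    rewrite ler_pdivrMr// (le_trans (_ : _ <= T^-1 ^+ 2 * N))//.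
      have := b2 a; have := b2 (- a); rewrite sqrrN -/N; lra.
    have -> : N * T^-1 * (T^-1 * (1 + T^-1 ^+ 2)) =
      T^-1 ^+ 2 * N + T^-1 ^+ 2 * N * T^-1 ^+ 2 by ring.
    by rewrite lerDl !mulr_ge0// ltW.
  lra.
have cG : G T @[T --> +oo] --> pi * (sig - mr).
  have -> : pi * (sig - mr) = G1 0 + sig * (pi / 2 + pi / 2) - 2 * mr * (pi / 2).
    by rewrite G10; field.
  have ca c : atan ((T * N + c) / b) @[T --> +oo] --> pi / 2.
    apply: (@cvg_comp _ _ _ (fun T => (T * N + c) / b) (@atan R) _ (+oo)); last exact: cvgy_atan.
    apply/cvgryPge => A.
    apply: filterS (nbhs_pinfty_ge (num_real ((A * b - c) / N))) => T.
    by rewrite ler_pdivrMr// lerBlDr ler_pdivlMr.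
  apply: cvgB; last by apply: cvgM; [exact: cvg_cst|exact: cvgy_atan].
  apply: cvgD; last by apply: cvgM; [exact: cvg_cst|apply: cvgD; exact: ca].
  apply: (@cvg_comp _ _ _ (fun T : R => T^-1) G1 _ (nbhs 0)); last exact: cG1.
  apply/gtr0_cvgV0; last by exact: cvg_id.
  exact: nbhs_pinfty_gt.
near=> T; apply: (le_trans (GE T _ _)).
- by near: T; apply: nbhs_pinfty_gt.
- by near: T; apply: nbhs_pinfty_gt; rewrite num_real.
- rewrite /prim_lim -/mr -/mi -/sig.
  near: T; move/cvgrPdist_le: cG => /(_ _ e0); apply: filterS => T.
  by rewrite distrC ler_norml => /andP[_]; rewrite lerBlDl.
Unshelve. all: by end_near.
Qed.

Definition qmin x : R := Num.min `|x| (x ^+ 2).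

Definition psat x : R := x ^+ 2 / (1 + x ^+ 2).

(* [- prim_lim a b / pi], by [prim_limE] *)
Let half_plane_mean a b : R :=
  (a ^+ 2 * (1 - b) - b ^+ 2 * (1 + b)) / ((1 + b) ^+ 2 + a ^+ 2).

Let mean_ge_lin a b : 0 <= b -> - (2 * b) <= half_plane_mean a b.
Proof.
move=> b0; have D0 : 0 < (1 + b) ^+ 2 + a ^+ 2.
  by rewrite ltr_wpDr ?sqr_ge0// exprn_even_gt0//= gt_eqF// ltr_wpDr.
rewrite ler_pdivlMr// -subr_ge0.
have -> : a ^+ 2 * (1 - b) - b ^+ 2 * (1 + b) -
  - (2 * b) * ((1 + b) ^+ 2 + a ^+ 2) =
  a ^+ 2 + a ^+ 2 * b + 2 * b + 3 * b ^+ 2 + b ^+ 2 * b by ring.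
have a2 := sqr_ge0 a; have ab := mulr_ge0 a2 b0.
have b2 := sqr_ge0 b; have := mulr_ge0 b2 b0; lra.
Qed.

(** Raising b by m/8 costs B^2 <= 2 b^2 + m^2/32. As m <= |a|, the m^2 part amounts to at most
    11/256 [psat a], against a gain of 5/16 [psat a]. *)
Let mean_ge_psat a b (m : R) : 0 <= b <= 1 / 4 -> 0 <= m <= 1 -> m <= `|a| ->
  1 / 100 * psat a - 20 * b ^+ 2 <= half_plane_mean a (b + m / 8).
Proof.
move=> /andP[b0 b1] /andP[m0 m1] ma; rewrite /half_plane_mean /psat.
have m2 : m ^+ 2 <= a ^+ 2.
  by rewrite -(real_normK (num_real a)) lerXn2r ?nnegrE// (le_trans m0).
set B := b + m / 8.
have B0 : 0 <= B by rewrite /B; lra.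
have B1 : B <= 3 / 8 by rewrite /B; lra.
have B2 : B ^+ 2 <= 2 * b ^+ 2 + m ^+ 2 / 32.
  by rewrite /B -subr_ge0 [leRHS](_ : _ = (b - m / 8) ^+ 2) ?sqr_ge0//; field.
have BB : B ^+ 2 <= 9 / 64 by nra.
clearbody B.
have : 0 <= a ^+ 2 by exact: sqr_ge0.
have bb : 0 <= b ^+ 2 by exact: sqr_ge0.
move: (a ^+ 2) m2 => X m2 X0.
have D0 : 0 < (1 + B) ^+ 2 + X by nra.
have X1 : 0 < 1 + X by lra.
have E1 : 5 / 16 * (X / (1 + X)) <= X * (1 - B) / ((1 + B) ^+ 2 + X).
  rewrite ler_pdivlMr// mulrA mulrAC ler_pdivrMr//.
  have : (1 + B) ^+ 2 + X <= 2 * (1 + X) by nra.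
  nra.
have E2 : B ^+ 2 * (1 + B) / ((1 + B) ^+ 2 + X) <=
    11 / 4 * b ^+ 2 + 11 / 256 * (X / (1 + X)).
  rewrite ler_pdivrMr//.
  have -> : 11 / 4 * b ^+ 2 + 11 / 256 * (X / (1 + X)) =
     (11 / 4 * b ^+ 2 * (1 + X) + 11 / 256 * X) / (1 + X).
    by field; rewrite gt_eqF.
  rewrite [leRHS]mulrAC ler_pdivlMr//.
  apply: (@le_trans _ _ ((11 / 4 * b ^+ 2 * (1 + X) + 11 / 256 * X) * (1 + X))).
    by rewrite ler_pM2r//; nra.
  rewrite ler_wpM2l//; nra.
rewrite mulrBl.
have P0 : 0 <= X / (1 + X) by rewrite divr_ge0// ltW.
lra.
Qed.

(* [B] may exceed [|b|]: this only increases [|1 - tc|], while [B > 0] removes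
   the logarithmic singularities on the real line. *)
Definition kern_primitive a b (B : R) (Phi : R -> R) : Prop :=
  [/\ `|b| <= B,
      forall t, 0 < quad a B t,
      forall t, 0 < t -> is_derive t 1 Phi
        ((ln (quad a B t) + ln (quad (- a) B t)) / 2 * kern t) &
      forall e : R, 0 < e -> \forall T \near +oo,
        Phi T - Phi T^-1 <= pi * (20 * qmin b - 1 / 100 * psat a) + e].

(** For |b| >= 1/4 the height |b| itself works, because [qmin b >= |b| / 4] absorbs every loss; only
    c = i and c = -i are moved, to height 2. For smaller |b| the height is raised by min(1, |a|)/8:
    it is then positive unless c = 0, stays below 1, and the raise is cheap compared with [psat a].
    For c = 0 the integrand vanishes. *)
Lemma kern_primitive_exists a b : exists B Phi, kern_primitive a b B Phi.
Proof.
have main (B : R) : `|b| <= B -> 0 < B -> (a != 0) || (B != 1) ->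
    1 / 100 * psat a - 20 * qmin b <= half_plane_mean a B ->
    exists B Phi, kern_primitive a b B Phi.
  move=> bB B0 aB h; exists B, (prim a B); split => //.
  - by move=> t; rewrite quad_gt0// gt_eqF.
  - by move=> t t0; exact: is_derive_prim.
  - move=> e e0; apply: filterS (prim_le_lim a B0 e0) => T /le_trans; apply.
    by rewrite lerD2r prim_limE// mulNr -mulrN ler_pM2l ?pi_gt0// lerNl opprB.
have psat_le1 : psat a <= 1.
  rewrite /psat ler_pdivrMr ?mul1r ?lerDr ?ler01//.
  by rewrite ltr_pwDl// sqr_ge0.
have [b4|b4] := leP (1 / 4) `|b|.
  have q4 : `|b| / 4 <= qmin b.
    by rewrite /qmin le_min -(real_normK (num_real b)); apply/andP; split; nra.
  have [ab|] := boolP ((a != 0) || (`|b| != 1)).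
    apply: (main `|b|) => //; first by lra.
    by have := @mean_ge_lin a `|b| (normr_ge0 _); lra.
  rewrite negb_or !negbK => /andP[_ /eqP b1].
  apply: (main 2); [lra|lra| |].
    by rewrite [2 == 1]gt_eqF ?orbT//; lra.
  by have := @mean_ge_lin a 2 (ler0n _ _); lra.
have qb : qmin b = `|b| ^+ 2.
  rewrite /qmin -(real_normK (num_real b)); apply/min_idPr.
  by rewrite expr2 ler_piMr//; lra.
have [/andP[/eqP a0 /eqP b0]|ab] := boolP ((a == 0) && (b == 0)).
  exists 0, (fun=> 0); rewrite a0 b0; split => //.
  - by rewrite normr0.
  - by move=> t; rewrite /quad; lra.
  - move=> t t0; apply: is_derive_eq (is_derive_cstl _ _) _.
    by rewrite /quad oppr0 !mulr0 subr0 expr1n expr0n addr0 ln1 addr0 !mul0r.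
  - move=> e e0; apply: nearW => T.
    rewrite subrr /qmin /psat normr0 expr0n/= minxx mulr0 !mul0r mulr0 subr0 mulr0 add0r.
    exact: ltW.
pose m := Num.min 1 `|a|.
have m0 : 0 <= m by rewrite /m le_min normr_ge0 ler01.
have m1 : m <= 1 by rewrite /m ge_min lexx.
have ma : m <= `|a| by rewrite /m ge_min lexx orbT.
apply: (main (`|b| + m / 8)).
- lra.
- move: ab; rewrite negb_and => /orP[a0|b0].
    have : 0 < m by rewrite /m lt_min normr_gt0 a0 ltr01.
    by have := normr_ge0 b; lra.
  have : 0 < `|b| by rewrite normr_gt0.
  lra.
- by apply/orP; right; rewrite lt_eqF//; lra.
- by rewrite qb; apply: mean_ge_psat => //; apply/andP; split => //; lra.
Qed.

End LogKernel.

Section IntegralMonotone.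
Local Open Scope ereal_scope.

(* Unlike [ge0_le_integral], no measurability is required. *)
Lemma integral_le_ge0 d (T : measurableType d) (R : realType)
    (mu : {measure set T -> \bar R}) (D : set T) (f g : T -> \bar R) :
  (forall x, D x -> f x <= g x) -> (forall x, D x -> 0 <= g x) ->
  \int[mu]_(x in D) f x <= \int[mu]_(x in D) g x.
Proof.
move=> fg g0; rewrite integralE [leRHS](ge0_integralE _ g0).
apply: (@le_trans _ _ (\int[mu]_(x in D) f^\+ x)).
  by rewrite geeDl// oppe_le0; apply: integral_ge0 => x _; exact: funeneg_ge0.
rewrite ge0_integralE; last by move=> x _; exact: funepos_ge0.
apply: ereal_sup_le => _ /= [h hf <-]; exists h => // x.
apply: le_trans (hf x) _; rewrite /patch; case: ifPn => // /set_mem Dx.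
by rewrite funeposE ge_max fg// g0.
Qed.

End IntegralMonotone.

(** * Integrals over segments, and measurability of the inverse *)

Section RealIntegrals.
Variable R : realType.
Let mu := @lebesgue_measure R.

Lemma integral_is_derive (F g : R -> R) (lo hi : R) : lo < hi ->
  {in `[lo, hi], forall t : R, is_derive t 1 F (g t)} ->
  {in `[lo, hi], continuous g} ->
  (\int[mu]_(t in `[lo, hi]) (g t)%:E = (F hi - F lo)%:E)%E.
Proof.
move=> lohi DF cg; rewrite (@continuous_FTC2 _ g F)//.
- by apply: continuous_in_subspaceT => t; rewrite inE; exact: cg.
- have cF t : t \in `[lo, hi] -> {for t, continuous F}.
    by move=> /DF; exact: is_derive_continuous.
  split.
  + move=> t tI; have /DF Dt : t \in `[lo, hi] by exact: subset_itv_oo_cc tI.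
    exact: (@ex_derive _ _ _ _ _ _ _ Dt).
  + by apply: cvg_at_right_filter; apply: cF; rewrite bound_itvE ltW.
  + by apply: cvg_at_left_filter; apply: cF; rewrite bound_itvE ltW.
- move=> t tI; have /DF Dt : t \in `[lo, hi] by exact: subset_itv_oo_cc tI.
  by rewrite derive1E (@derive_val _ _ _ _ _ _ _ Dt).
Qed.

(** This folding is what cancels the odd terms [t * a]; the segments avoid 0, where the kernel is
    singular. *)
Lemma integral_symmetric (f : R -> R) (lo hi : R) : 0 < lo -> lo < hi ->
  (forall t, t != 0 -> {for t, continuous f}) ->
  (\int[mu]_(t in `[(- hi)%R, (- lo)%R]) (f t)%:E +
   \int[mu]_(t in `[lo, hi]) (f t)%:E =
   \int[mu]_(t in `[lo, hi]) (f t + f (- t))%:E)%E.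
Proof.
move=> lo0 lohi cf.
have cP : {in `[lo, hi], continuous f}.
  move=> t; rewrite in_itv/= => /andP[lot _]; apply: cf.
  by rewrite gt_eqF// (lt_le_trans lo0).
have cN : {in `[(- hi), (- lo)], continuous f}.
  move=> t; rewrite in_itv/= => /andP[_ lot]; apply: cf.
  by rewrite lt_eqF// (le_lt_trans lot)// oppr_lt0.
have cNP : {in `[lo, hi], continuous (fun t => f (- t))}.
  move=> t; rewrite in_itv/= => /andP[lot _].
  apply: (@continuous_comp _ _ _ -%R f); first exact: opp_continuous.
  by apply: cf; rewrite oppr_eq0 gt_eqF// (lt_le_trans lo0).
have sub (g : R -> R) (i : interval R) : {in i, continuous g} ->
    {within [set` i], continuous g}.
  by move=> cg; apply: continuous_in_subspaceT => t; rewrite inE; exact: cg.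
rewrite integration_by_substitution_oppr ?(ltW lohi)//; last exact: sub.
rewrite addeC -integralD//; last 2 first.
- apply: continuous_compact_integrable; [exact: segment_compact|exact: sub].
- by apply: continuous_compact_integrable; [exact: segment_compact|exact: sub].
Qed.

Lemma measurable_invr : measurable_fun [set: R] (@GRing.inv R).
Proof.
rewrite (_ : GRing.inv = fun x : R => x * (x ^+ 2) `^ (-1)).
  apply: measurable_funM => //.
  exact: (measurableT_comp (measurable_powR (-1))).
apply/funext => x; rewrite powR_inv1 ?sqr_ge0//.
have [->|x0] := eqVneq x 0; first by rewrite invr0 mul0r.
by field.
Qed.

End RealIntegrals.

(** * The mean inequality for finitely many factors *)

Section LogProductMean.
Variable R : realType.
Let mu := @lebesgue_measure R.
Implicit Types (t x tau : R).

Lemma kern_ge0 x : 0 <= kern x.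
Proof. by rewrite /kern divr_ge0 ?sqr_ge0// addr_ge0// mulr_ge0// sqr_ge0. Qed.

Lemma kernN x : kern (- x) = kern x.
Proof. by rewrite /kern !sqrrN mulNr sqrrN. Qed.

(** Makes a Gaussian factor exp(eta t^2) affordable: the right-hand side has integral 3 pi over the
    line. *)
Lemma sqr_kern_le x : x ^+ 2 * kern x <= 3 / (1 + x ^+ 2).
Proof.
have x1 : 0 < 1 + x ^+ 2 by rewrite ltr_pwDl// sqr_ge0.
have [->|x0] := eqVneq x 0; first by rewrite expr0n/= mul0r divr_ge0// addr0.
rewrite ler_pdivlMr// /kern.
have -> : x ^+ 2 * ((3 * x ^+ 2 + 1) / (x * (1 + x ^+ 2)) ^+ 2) * (1 + x ^+ 2)
   = (3 * x ^+ 2 + 1) / (1 + x ^+ 2) by field; rewrite x0 gt_eqF.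
by rewrite ler_pdivrMr// mulrDr addrC lerD2r; lra.
Qed.

(** With x = tau/|t|, the left-hand side times |t| is of order x for large x and x^3 for small x;
    min(x, x^2) is the weaker form that fits [integral_qmin_le]. At t = 0 both sides are 0 by the
    convention on division. *)
Lemma kern_scale_le t tau : 0 < tau ->
  kern (t / tau) / tau <= 3 / `|t| * qmin (tau / t).
Proof.
move=> tau0; have [->|t0] := eqVneq t 0.
  by rewrite mul0r /kern mul0r expr0n normr0 invr0 !mulr0 !mul0r.
have tn : 0 < `|t| by rewrite normr_gt0.
pose x := tau / `|t|.
have x0 : 0 < x by rewrite divr_gt0.
have -> : qmin (tau / t) = Num.min x (x ^+ 2).
  by rewrite /qmin normrM normfV (gtr0_norm tau0) /x !exprMn !exprVn real_normK// num_real.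
have -> : kern (t / tau) / tau = `|t|^-1 * ((3 + x ^+ 2) * x ^+ 3 / (1 + x ^+ 2) ^+ 2).
  rewrite /kern !exprMn -(real_normK (num_real t)) /x; field.
  rewrite gt_eqF// !gt_eqF//=.
  by rewrite ltr_wpDl ?sqr_ge0// exprn_gt0.
have x1 : 0 < (1 + x ^+ 2) ^+ 2 by rewrite exprn_gt0// ltr_pwDl// sqr_ge0.
rewrite [leRHS](_ : _ = `|t|^-1 * (3 * Num.min x (x ^+ 2))); last by ring.
rewrite ler_pM2l ?invr_gt0//.
rewrite minr_pMr//= le_min !ler_pdivrMr//.
have x3 : 0 <= x ^+ 3 by rewrite exprn_ge0 ?ltW.
have x4 : 0 <= x ^+ 2 by rewrite sqr_ge0.
apply/andP; split.
  rewrite -subr_ge0.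
  have -> : 3 * x * (1 + x ^+ 2) ^+ 2 - (3 + x ^+ 2) * x ^+ 3 =
    x * (3 + 3 * x ^+ 2 + 2 * (x ^+ 2) ^+ 2) by ring.
  by rewrite mulr_ge0 ?(ltW x0)//; nra.
have -> : (3 + x ^+ 2) * x ^+ 3 = x ^+ 2 * ((3 + x ^+ 2) * x) by ring.
rewrite [leRHS](_ : _ = x ^+ 2 * (3 * (1 + x ^+ 2) ^+ 2)); last by ring.
rewrite ler_pM2l ?exprn_gt0//.
have : x <= 1 + x ^+ 2 by nra.
nra.
Qed.

Lemma measurable_kern : measurable_fun [set: R] (@kern R).
Proof.
apply: measurable_funM.
  by apply: measurable_funD => //; apply: measurable_funM => //;
    exact: measurable_funX.
apply: (measurableT_comp (@measurable_invr R)).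
apply: measurable_funX; apply: measurable_funM => //.
by apply: measurable_funD => //; exact: measurable_funX.
Qed.

Lemma continuous_kern x : x != 0 -> {for x, continuous (@kern R)}.
Proof.
move=> x0.
have D (k : R) : is_derive x 1 (fun=> k) 0 := is_derive_cstl k x.
have I := is_derive_idl x.
have X2 := is_deriveMl I I.
have Dd := is_deriveMl I (is_deriveDl (D 1) X2).
have d0 : (x * (1 + x * x)) * (x * (1 + x * x)) != 0.
  by rewrite !mulf_neq0// gt_eqF// -expr2 ltr_pwDl// sqr_ge0.
exact: (is_derive_continuous (is_deriveMl (is_deriveDl (is_deriveMl (D 3) X2) (D 1))
  (@is_deriveVl R (fun x => (x * (1 + x * x)) * (x * (1 + x * x))) _ _ d0
    (is_deriveMl Dd Dd)))).
Qed.

(** The term [eta * t ^+ 2] stands for the factors beyond the first n. The hypothesis on [u] ranges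
    over all heights [B], since those given by [kern_primitive_exists] are chosen for the points tau
    c_k and so vary with tau. *)
Lemma log_product_mean (n : nat) (a b : 'I_n -> R) (eta tau : R)
    (u : R -> \bar R) : 0 <= eta -> 0 < tau ->
  measurable_fun setT u -> (forall t, 0 <= u t)%E ->
  (forall (B : 'I_n -> R) t,
     (forall k, `|b k| <= B k /\ 0 < quad (a k) (B k) t) ->
     ((- \sum_(k < n) (ln (quad (a k) (B k) t) / 2 + t * a k)
        - eta * t ^+ 2)%:E <= u t)%E) ->
  ((\sum_(k < n) pi * (1 / 100 * psat (tau * a k) - 20 * qmin (tau * b k))
     - 3 * pi * eta * tau ^+ 2)%:E <=
   \int[mu]_t (u t * (kern (t / tau) / tau)%:E))%E.
Proof.
move=> eta0 tau0 mu_ u0 hu; have tauN0 : tau != 0 by rewrite gt_eqF.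
have [B /choice[Phi hB]] := choice (fun k => kern_primitive_exists (tau * a k) (tau * b k)).
pose l k (t : R) := ln (quad (a k) (B k / tau) t) / 2 + t * a k.
have quadE k c t : quad (tau * c) (B k) (t / tau) = quad c (B k / tau) t.
  by rewrite /quad; field.
have q_gt0 k t : 0 < quad (a k) (B k / tau) t.
  have [_ + _ _] := hB k; move=> /(_ (t / tau)).
  by rewrite quadE.
have bB k : `|b k| <= B k / tau.
  have [+ _ _ _] := hB k.
  by rewrite ler_pdivlMr// normrM (gtr0_norm tau0) mulrC.
pose err t := 3 * eta * tau / (1 + (t / tau) ^+ 2).
pose f t := (- \sum_(k < n) l k t) * (kern (t / tau) / tau) - err t.
have f_le t : ((f t)%:E <= u t * (kern (t / tau) / tau)%:E)%E.
  have k0 : 0 <= kern (t / tau) / tau by rewrite divr_ge0 ?kern_ge0 ?ltW.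
  have /= := hu (fun k => B k / tau) t (fun k => conj (bB k) (q_gt0 k t)).
  rewrite -/(l^~ t) => /(lee_wpmul2r (_ : 0 <= (kern (t / tau) / tau)%:E)%E).
  rewrite lee_fin => /(_ k0); apply: le_trans.
  rewrite -EFinM lee_fin /f mulrBl lerD2l lerN2 /err.
  have -> : eta * t ^+ 2 * (kern (t / tau) / tau) =
    eta * tau * ((t / tau) ^+ 2 * kern (t / tau)) by field.
  have -> : 3 * eta * tau / (1 + (t / tau) ^+ 2) =
    eta * tau * (3 / (1 + (t / tau) ^+ 2)) by ring.
  by rewrite ler_wpM2l ?mulr_ge0 ?(ltW tau0)// sqr_kern_le.
have u_kern_ge0 t : (0 <= u t * (kern (t / tau) / tau)%:E)%E.
  by rewrite mule_ge0// lee_fin divr_ge0 ?kern_ge0 ?ltW.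
(* A primitive of the folded integrand [f t + f (- t)]; the 6 is the 3 of [err] doubled by
   folding. *)
pose F t := - \sum_(k < n) Phi k (t / tau) - 6 * eta * tau ^+ 2 * atan (t / tau).
have Dtau t : is_derive t 1 (fun t => t / tau) tau^-1.
  apply: is_derive_eq (is_deriveMl (is_derive_idl t) (is_derive_cstl tau^-1 t)) _.
  by rewrite mulr0 mul1r add0r.
have DF t : 0 < t -> is_derive t 1 F (f t + f (- t)).
  move=> t0.
  have DPhi k : is_derive t 1 (fun t => Phi k (t / tau))
      ((l k t + l k (- t)) * (kern (t / tau) / tau)).
    have [_ _ /(_ (t / tau)) Dk _] := hB k.
    apply: is_derive_eq (@is_derive1_comp R (Phi k) (fun t => t / tau) t _ _
      (Dk (divr_gt0 t0 tau0)) (Dtau t)) _.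

    by rewrite /l quadN -mulrN !quadE; ring.
  have -> : f t + f (- t) = - (\sum_(k < n) (l k t + l k (- t)) *
      (kern (t / tau) / tau)) - 6 * eta * tau ^+ 2 * (tau^-1 / (1 + (t / tau) ^+ 2)).
    rewrite /f /err [- t / tau]mulNr kernN sqrrN -mulr_suml.
    have -> : \sum_(k < n) (l k t + l k (- t)) =
      \sum_(k < n) l k t + \sum_(k < n) l k (- t) by rewrite big_split.
    field.
    by rewrite tauN0/= gt_eqF// ltr_pwDr ?exprn_gt0// sqr_ge0.
  apply: is_derive_eq (is_deriveDl (is_deriveNl (is_derive_suml DPhi))
    (is_deriveNl (is_deriveMl (is_derive_cstl _ t) (is_derive_atanl (Dtau t))))) _.
  by rewrite mul0r addr0.
have cf t : t != 0 -> {for t, continuous f}.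
  move=> t0; have ctau : {for t, continuous (fun t => t / tau)}.
    exact: is_derive_continuous (Dtau t).
  have cl : {for t, continuous (fun t => \sum_(k < n) l k t)}.
    apply: is_derive_continuous (is_derive_suml _) => k.
    exact: is_deriveDl (is_deriveMl (is_derive_lnl (q_gt0 k t)
      (is_derive_quad _ _ _)) (is_derive_cstl 2^-1 t))
      (is_deriveMl (is_derive_idl t) (is_derive_cstl (a k) t)).
  have ck : {for t, continuous (fun t => kern (t / tau))}.
    apply: (@continuous_comp _ _ _ (fun t => t / tau) (@kern R) t ctau).
    by apply: continuous_kern; rewrite mulf_neq0// invr_eq0.
  apply: cvgB; first apply: cvgM; first exact: cvgN cl.
    by apply: cvgM; [exact: ck|exact: cvg_cst].
  have D0 : 1 + (t / tau) * (t / tau) != 0.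
    by rewrite gt_eqF// -expr2 ltr_pwDl// sqr_ge0.
  exact: (is_derive_continuous (is_deriveMl (is_derive_cstl (3 * eta * tau) t)
   (@is_deriveVl R (fun t => 1 + (t / tau) * (t / tau)) _ _ D0 (is_deriveDl (is_derive_cstl 1 t)
     (is_deriveMl (Dtau t) (Dtau t)))))).
apply/lee_subgt0Pr => e e0.
pose V k := pi * (20 * qmin (tau * b k) - 1 / 100 * psat (tau * a k)).
(* One T serves all factors. Dividing [e] by n+1 instead of n covers the empty product. *)
have : \forall T \near +oo, 1 < T /\ forall k : 'I_n,
    Phi k T - Phi k T^-1 <= V k + e / n.+1%:R.
  near=> T; split; first by near: T; apply: nbhs_pinfty_gt.
  near: T; apply: filter_forall => k; have [_ _ _] := hB k; apply.
  by rewrite divr_gt0.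
move=> /(@filter_ex _ _ _)[T [T1 hT]].
have T0 : 0 < T by rewrite (lt_trans _ T1).
pose lo := T^-1 * tau; pose hi := T * tau.
have lo0 : 0 < lo by rewrite mulr_gt0 ?invr_gt0.
have lohi : lo < hi.
  by rewrite ltr_pM2r// (lt_trans _ T1)// invf_lt1.
(* [u] times the kernel is nonnegative, so restricting it to two segments only lowers its
   integral. *)
have : (\int[mu]_(t in `[(- hi)%R, (- lo)%R]) (f t)%:E +
        \int[mu]_(t in `[lo, hi]) (f t)%:E <=
        \int[mu]_t (u t * (kern (t / tau) / tau)%:E))%E.
  have le1 (i : interval R) : (\int[mu]_(t in [set` i]) (f t)%:E <=
      \int[mu]_(t in [set` i]) (u t * (kern (t / tau) / tau)%:E))%E.
    by apply: integral_le_ge0 => t _.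
  apply: (le_trans (leeD (le1 _) (le1 _))).
  have mk : measurable_fun setT (fun t => (u t * (kern (t / tau) / tau)%:E))%E.
    apply: emeasurable_funM => //; apply/measurable_EFinP.
    apply: measurable_funM => //; 
    apply: (measurableT_comp measurable_kern).
    exact: measurable_funM.
  rewrite -ge0_integral_setU//=.
  - by apply: ge0_subset_integral => //; apply: measurableU.
  - exact: measurable_funTS.
  - apply/disj_setPS => t /= []; rewrite !in_itv/= => /andP[_ t1] /andP[t2 _].
    by have := lt_le_trans lo0 (le_trans t2 t1); rewrite oppr_gt0 ltNge (ltW lo0).
apply: le_trans.
rewrite integral_symmetric//.
rewrite (@integral_is_derive _ F)//; last 2 first.
- by move=> t; rewrite in_itv/= => /andP[lot _]; apply: DF; rewrite (lt_le_trans lo0).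
- move=> t; rewrite in_itv/= => /andP[lot _].
  have t0 : t != 0 by rewrite gt_eqF// (lt_le_trans lo0).
  apply: cvgD; first exact: cf.
  apply: (@continuous_comp _ _ _ -%R f); first exact: opp_continuous.
  by apply: cf; rewrite oppr_eq0.
rewrite -EFinB lee_fin /F /hi /lo !mulfK//.
have : \sum_(k < n) (Phi k T - Phi k T^-1) <= \sum_(k < n) (V k + e / n.+1%:R).
  exact: ler_sum.
rewrite sumrB big_split/= sumr_const card_ord.
have : (e / n.+1%:R) *+ n <= e.
  rewrite -mulr_natr mulrAC ler_pdivrMr ?ltr0n// ler_wpM2l ?(ltW e0)// ler_nat.
  exact: leqnSn.
have : atan T - atan T^-1 <= pi / 2.
  have : 0 <= atan T^-1 by rewrite -atan0 le_atan// invr_ge0 ltW.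
  have := @atan_ltpi2 _ T; lra.
have c6 : 0 <= 6 * eta * tau ^+ 2 by rewrite mulr_ge0 ?sqr_ge0// mulr_ge0.
move=> /(ler_wpM2l c6).
have -> : \sum_(k < n) pi * (1 / 100 * psat (tau * a k) - 20 * qmin (tau * b k)) =
  - \sum_(k < n) V k.
  rewrite -sumrN; apply: eq_bigr => k _; rewrite /V; ring.
rewrite mulrBr; move: (_ *+ n) (\sum_(k < n) V k) (6 * eta * tau ^+ 2 * _)
  (6 * eta * tau ^+ 2 * _) => ? ? ? ?; lra.
Unshelve. all: by end_near.
Qed.

End LogProductMean.

(** * Canonical products *)

Section ComplexModulus.
Variable R : realType.
Implicit Types (w : R[i]) (x y : R).
Local Open Scope complex_scope.

Lemma cmodE x y : cmod (x +i* y) = Num.sqrt (x ^+ 2 + y ^+ 2).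
Proof. by []. Qed.

Lemma cmod_ge0 w : 0 <= cmod w.
Proof. by case: w => x y; rewrite cmodE sqrtr_ge0. Qed.

Lemma cmodM w1 w2 : cmod (w1 * w2) = cmod w1 * cmod w2.
Proof. exact: Normc.normcM. Qed.

Lemma cmod_real x : cmod x%:C = `|x|.
Proof. by rewrite cmodE expr0n addr0 sqrtr_sqr. Qed.

Lemma cmod0 : cmod (0 : R[i]) = 0.
Proof. exact: Normc.normc0. Qed.

Lemma cmod1 : cmod (1 : R[i]) = 1.
Proof. exact: Normc.normc1. Qed.

Lemma sqr_cmod w : cmod w ^+ 2 = complex.Re w ^+ 2 + complex.Im w ^+ 2.
Proof. by case: w => x y; rewrite cmodE sqr_sqrtr// addr_ge0 ?sqr_ge0. Qed.

Lemma cmodRI w : cmod w = Num.sqrt (complex.Re w ^+ 2 + complex.Im w ^+ 2).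
Proof. by case: w. Qed.

Lemma cmod_cexp w : cmod (cexp w) = expR (complex.Re w).
Proof.
rewrite /cexp cmodE !exprMn -mulrDr cos2Dsin2 mulr1 sqrtr_sqr.
by rewrite ger0_norm// expR_ge0.
Qed.

Lemma cmodD w1 w2 : cmod (w1 + w2) <= cmod w1 + cmod w2.
Proof. exact: (@le_normcD R). Qed.

Lemma cmodN w : cmod (- w) = cmod w.
Proof. exact: (@normcN R). Qed.

Lemma cmod_E1 w : cmod (E1 w) =
  Num.sqrt ((1 - complex.Re w) ^+ 2 + complex.Im w ^+ 2) * expR (complex.Re w).
Proof.
by rewrite /E1 cmodM cmod_cexp [cmod (1 - w)]cmodRI !raddfB/= sub0r sqrrN.
Qed.

(** For w = x + iy, |1 - w|^2 = 1 + (|w|^2 - 2x) <= exp(|w|^2 - 2x), and the exponential factor of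
    [E1] cancels the linear term. Since w is arbitrary, a whole tail can be bounded at any point. *)
Lemma cmod_E1_le_sqr w : cmod (E1 w) <= expR (cmod w ^+ 2 / 2).
Proof.
rewrite cmod_E1 sqr_cmod.
move: (complex.Re w) (complex.Im w) => x y.
rewrite -ler_pdivlMr ?expR_gt0// -expRN -expRD.
rewrite -[leRHS]gtr0_norm ?expR_gt0// -sqrtr_sqr ler_wsqrtr//.
rewrite -expRM_natl (le_trans _ (expR_ge1Dx _))//.
by rewrite le_eqVlt; apply/orP; left; apply/eqP; field.
Qed.

Lemma cmod_E1_le_lin w : cmod (E1 w) <= expR (2 * cmod w).
Proof.
have xw : complex.Re w <= cmod w.
  rewrite (le_trans (ler_norm _))// -sqrtr_sqr.
  by rewrite cmodRI ler_wsqrtr// lerDl sqr_ge0.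
rewrite mulr_natl mulr2n expRD /E1 cmodM cmod_cexp.
apply: ler_pM; rewrite ?cmod_ge0 ?expR_ge0 ?ler_expR//.
rewrite (le_trans _ (expR_ge1Dx _))//.
rewrite (le_trans (cmodD _ _))// cmodN.
by rewrite cmod1.
Qed.

Lemma cmod_E1_le w : cmod (E1 w) <= expR (2 * qmin (cmod w)).
Proof.
rewrite /qmin (ger0_norm (cmod_ge0 _)) /Num.min; case: ifPn => _.
  exact: cmod_E1_le_lin.
rewrite (le_trans (cmod_E1_le_sqr w))// ler_expR.
by have := sqr_ge0 (cmod w); lra.
Qed.

(* No convergence is needed: the [lim] of a divergent sequence is [0]. *)
Lemma cmod_lim_le (P : nat -> R[i]) (n : nat) (M : R) : 0 <= M ->
  (forall m, (n <= m)%N -> cmod (P m) <= M) ->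
  cmod (lim ((P : nat -> (R[i])^o) @ \oo)) <= M.
Proof.
move=> M0 PM.
have [/cvgrPdist_lt cP|/dvgP ->] := pselect (cvg ((P : nat -> (R[i])^o) @ \oo));
  last by rewrite [cmod _]cmod0.
apply/ler_addgt0Pr => e e0.
have /cP [m0 _ hm] : 0 < e%:C by rewrite ltcR.
pose m := maxn m0 n.
have /= := hm m (leq_maxl _ _).
set l := lim _ => lP.
have {}lP : cmod (l - P m) < e.
  by move: lP; rewrite normc_def cmodRI ltcR.
have := cmodD (l - P m) (P m); rewrite subrK => /le_trans; apply.
by rewrite addrC; exact: lerD (PM _ (leq_maxr _ _)) (ltW lP).
Qed.

End ComplexModulus.

(** * Integrals of [qmin] and [psat] against powers *)

Section PowerIntegrals.
Variable R : realType.
Let mu := @lebesgue_measure R.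
Implicit Types (r s h q p : R).

Lemma integral_halfline_le (g : R -> \bar R) h (C : \bar R) : 0 < h ->
  measurable_fun setT g -> (forall r, (0 <= g r)%E) ->
  (forall n : nat, (\int[mu]_(r in `[(h / n.+2%:R)%R, (h * n.+2%:R)%R]) g r <= C)%E) ->
  (\int[mu]_(r in `]0%R, +oo[) g r <= C)%E.
Proof.
move=> h0 mg g0 gC.
(* With n+2, the point [h] is strictly inside every segment, which can then be split there. *)
pose S n : set R := `[h / n.+2%:R, h * n.+2%:R]%classic.
have SE : `]0, +oo[%classic = \bigcup_n S n.
  apply/seteqP; split => r /=.
    rewrite in_itv/= andbT => r0.
    pose n := (Num.truncn (r / h + h / r)).
    exists n => //; rewrite /S /= in_itv/=.
    have hn : r / h + h / r <= n.+2%:R.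
      rewrite (le_trans (ltW (truncnS_gt _)))// ler_nat leqnSn//.
    have rh : 0 < r / h by rewrite divr_gt0.
    have hr : 0 < h / r by rewrite divr_gt0.
    apply/andP; split.
      by rewrite ler_pdivrMr ?ltr0n// -ler_pdivrMl// mulrC; lra.
    by rewrite -ler_pdivrMl// mulrC; lra.
  move=> [n _]; rewrite /S /= !in_itv/= andbT => /andP[+ _]; apply: lt_le_trans.
  by rewrite divr_gt0.
have cS : (\int[mu]_(r in S n) g r)%E @[n --> \oo] -->
    (\int[mu]_(r in \bigcup_n S n) g r)%E.
  apply: (@ge0_nondecreasing_set_cvg_integral _ (measurableTypeR R) R S g
    lebesgue_measure).
  - move=> m n mn; apply/subsetPset => r; rewrite /S /= !in_itv/= => /andP[r1 r2].
    rewrite (le_trans _ r1)/= ?(le_trans r2)//.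
      by rewrite ler_pM2l// ler_nat.
    by rewrite ler_pM2l// lef_pV2 ?posrE ?ltr0n// ler_nat.
  - by move=> n; exact: measurable_itv.
  - by move=> n; exact: measurable_funTS.
  - by move=> n r _; exact: g0.
rewrite SE -(cvg_lim _ cS)//; apply: lime_le; last exact: nearW.
by apply/cvg_ex; eexists; exact: cS.
Qed.

Lemma integral_powR q (lo hi : R) : q + 1 != 0 -> 0 < lo -> lo < hi ->
  (\int[mu]_(r in `[lo, hi]) (r `^ q)%:E =
   ((hi `^ (q + 1) - lo `^ (q + 1)) / (q + 1))%:E)%E.
Proof.
move=> q0 lo0 lohi; rewrite mulrBl.
apply: (@integral_is_derive _ (fun r => r `^ (q + 1) / (q + 1)) (fun r => r `^ q)) => // r;
  rewrite in_itv/= => /andP[/(lt_le_trans lo0) r0 _].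
  apply: is_derive_eq (is_deriveMl (is_derive1_powR (q + 1) r0)
    (is_derive_cstl _ _)) _.
  by rewrite addrK; field.
exact: is_derive_continuous (is_derive1_powR _ r0).
Qed.

(** For 1 < p < 2 this is the integral of min(x, x^2) x^(-p-1) over the half-line, split at x =
    1. *)
Definition qmin_const p : R := (2 - p)^-1 + (p - 1)^-1.

Lemma measurable_qmin : measurable_fun [set: R] (@qmin R).
Proof.
by apply: measurable_minr; [exact: normr_measurable|exact: measurable_funX].
Qed.

Lemma qmin_ge0 r : 0 <= qmin r.
Proof. by rewrite /qmin le_min normr_ge0 sqr_ge0. Qed.

Lemma qmin_norm r : qmin `|r| = qmin r.
Proof. by rewrite /qmin normr_id real_normK ?num_real. Qed.

Lemma integral_qmin_le p s : 1 < p < 2 ->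
  (\int[mu]_(r in `]0%R, +oo[) (qmin (r * s) / r `^ (p + 1))%:E <=
   (qmin_const p * `|s| `^ p)%:E)%E.
Proof.
move=> /andP[p1 p2].
have mf : measurable_fun setT (fun r => (qmin (r * s) / r `^ (p + 1))%:E).
  apply/measurable_EFinP; apply: measurable_funM.
    apply: (measurableT_comp measurable_qmin); exact: measurable_funM.
  apply: (measurableT_comp (@measurable_invr R)); exact: measurable_powR.
have f0 r : (0 <= (qmin (r * s) / r `^ (p + 1))%:E)%E.
  by rewrite lee_fin divr_ge0 ?qmin_ge0 ?powR_ge0.
have C0 : 0 < 2 - p by rewrite subr_gt0.
have C1 : 0 < p - 1 by rewrite subr_gt0.
have [->|s0'] := eqVneq s 0.
  rewrite integral0_eq.
    by rewrite lee_fin normr0 powR0 ?mulr0// gt_eqF//; lra.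
  by move=> r _; rewrite mulr0 /qmin normr0 expr0n minxx mul0r.
wlog s0 : s s0' mf f0 / 0 < s.
  move=> H; have [/H->//|s_le0] := ltP 0 s.
  have sN r : qmin (r * s) = qmin (r * - s).
    by rewrite -qmin_norm -[RHS]qmin_norm !normrM normrN.
  rewrite -normrN; under eq_integral do rewrite sN.
  have sneg : 0 < - s by rewrite oppr_gt0 lt_neqAle s0'.
  apply: H => //; first by rewrite oppr_eq0.
    by apply: eq_measurable_fun mf => r _; rewrite sN.
  by move=> r; rewrite -sN.
(* At [h] the minimum switches from (rs)^2 to rs; the two pieces yield the two terms of
   [qmin_const]. *)
rewrite gtr0_norm//; pose h := s^-1; have h0 : 0 < h by rewrite invr_gt0.
apply: (@integral_halfline_le _ h) => // n.
set lo := h / _; set hi := h * _.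
have lo0 : 0 < lo by rewrite divr_gt0.
have loh : lo < h by rewrite ltr_pdivrMr// ltr_pMr// ltr1n.
have hhi : h < hi by rewrite ltr_pMr// ltr1n.
have powRr r (i : nat) (z : R) : 0 < r -> r ^+ i / r `^ z = r `^ (i%:R - z).
  by move=> r0; rewrite powRB ?(gt_eqF r0) ?implybT// powR_mulrn// ltW.
have hE z : h `^ z = s `^ (- z).
  by rewrite /h -powR_inv1 ?(ltW s0)// -powRrM mulN1r.
have sE (i : nat) z : s ^+ i * s `^ z = s `^ (i%:R + z).
  by rewrite powRD ?(gt_eqF s0) ?implybT// powR_mulrn// ltW.
rewrite (@itv_bndbnd_setU _ _ (BLeft lo) (BRight h) (BRight hi))
  ?bnd_simp ?(ltW loh) ?(ltW hhi)//.
rewrite ge0_integral_setU//=; last 2 first.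
- exact: measurable_funTS.
- apply/disj_setPS => r /= []; rewrite !in_itv/= => /andP[_ r1] /andP[r2 _].
  by have := lt_le_trans r2 r1; rewrite ltxx.
rewrite /qmin_const mulrDl EFinD; apply: leeD.
  apply: (@le_trans _ _ (\int[mu]_(r in `[lo, h]) ((s ^+ 2)%:E * (r `^ (1 - p))%:E))%E).
    apply: integral_le_ge0 => r; rewrite /= in_itv/= => /andP[/(lt_le_trans lo0) r0 _];
      last by rewrite -EFinM lee_fin mulr_ge0 ?sqr_ge0 ?powR_ge0.
    rewrite -EFinM lee_fin (_ : 1 - p = 2%:R - (p + 1)); last by ring.
    rewrite -powRr// mulrA ler_wpM2r ?invr_ge0 ?powR_ge0//.
    by rewrite /qmin ge_min [s ^+ 2 * _]mulrC -exprMn lexx orbT.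
  rewrite ge0_integralZl//=; last 3 first.
  - by apply/measurable_EFinP/measurable_funTS; exact: measurable_powR.
  - by move=> r _; rewrite lee_fin powR_ge0.
  - by rewrite lee_fin sqr_ge0.
  rewrite integral_powR//; last by rewrite gt_eqF//; lra.
  rewrite -EFinM lee_fin (_ : 1 - p + 1 = 2%:R - p); last by ring.
  rewrite mulrA [_^-1 * _]mulrC ler_pM2r ?invr_gt0//.
  apply: (@le_trans _ _ (s ^+ 2 * h `^ (2%:R - p))).
    by rewrite ler_wpM2l ?sqr_ge0// lerBlDr lerDl powR_ge0.
  by rewrite hE sE opprB addrC subrK.
apply: (@le_trans _ _ (\int[mu]_(r in `[h, hi]) (s%:E * (r `^ (- p))%:E))%E).
  apply: (@le_trans _ _ (\int[mu]_(r in `[h, hi]) (qmin (r * s) / r `^ (p + 1))%:E)%E).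
    apply: ge0_subset_integral => //; first exact: measurable_funTS.
    by apply: subset_itvr; rewrite bnd_simp.
  apply: integral_le_ge0 => r; rewrite /= in_itv/= => /andP[/(lt_le_trans h0) r0 _];
    last by rewrite -EFinM lee_fin mulr_ge0 ?(ltW s0) ?powR_ge0.
  rewrite -EFinM lee_fin (_ : - p = 1%:R - (p + 1)); last by ring.
  rewrite -powRr// expr1 mulrA ler_wpM2r ?invr_ge0 ?powR_ge0//.
  by rewrite /qmin ge_min mulrC ger0_norm ?lexx// mulr_ge0 ?ltW.
rewrite ge0_integralZl//=; last 3 first.
- by apply/measurable_EFinP/measurable_funTS; exact: measurable_powR.
- by move=> r _; rewrite lee_fin powR_ge0.
- by rewrite lee_fin ltW.
rewrite integral_powR//; last by rewrite lt_eqF//; lra.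
rewrite -EFinM lee_fin.
have -> : s * ((hi `^ (- p + 1) - h `^ (- p + 1)) / (- p + 1)) =
  (p - 1)^-1 * (s * (h `^ (- p + 1) - hi `^ (- p + 1))).
  have e1 : - p + 1 != 0 by rewrite lt_eqF//; lra.
  have e2 : p - 1 != 0 by rewrite gt_eqF.
  by field; rewrite e1 e2.
rewrite ler_pM2l ?invr_gt0//.
apply: (@le_trans _ _ (s ^+ 1 * h `^ (- p + 1))).
  by rewrite expr1 ler_wpM2l ?(ltW s0)// lerBlDr lerDl powR_ge0.
by rewrite hE sE opprD opprK addrC subrK.
Qed.

Lemma measurable_psat : measurable_fun [set: R] (@psat R).
Proof.
apply: measurable_funM; first exact: measurable_funX.
apply: (measurableT_comp (@measurable_invr R)).
by apply: measurable_funD => //; exact: measurable_funX.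
Qed.

Lemma psat_ge0 r : 0 <= psat r.
Proof. by rewrite /psat divr_ge0 ?addr_ge0 ?sqr_ge0. Qed.

(** Only the segment [h, 2h] with h = 1/|s| is kept: there [psat] is at least 1/2 and the weight at
    least (2h)^(-p-1), over a length h. *)
Lemma integral_psat_ge p s : 0 < p ->
  ((2 `^ (- (p + 2)) * `|s| `^ p)%:E <=
   \int[mu]_(r in `]0%R, +oo[) (psat (r * s) / r `^ (p + 1))%:E)%E.
Proof.
move=> p0.
have mf : measurable_fun setT (fun r => (psat (r * s) / r `^ (p + 1))%:E).
  apply/measurable_EFinP; apply: measurable_funM.
    apply: (measurableT_comp measurable_psat); exact: measurable_funM.
  apply: (measurableT_comp (@measurable_invr R)); exact: measurable_powR.
have f0 r : (0 <= (psat (r * s) / r `^ (p + 1))%:E)%E.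
  by rewrite lee_fin divr_ge0 ?psat_ge0 ?powR_ge0.
have [->|s0'] := eqVneq s 0.
  rewrite normr0 powR0 ?gt_eqF// mulr0; apply: integral_ge0 => r _.
  by rewrite lee_fin divr_ge0 ?psat_ge0 ?powR_ge0.
have s0 : 0 < `|s| by rewrite normr_gt0.
pose h := `|s|^-1; have h0 : 0 < h by rewrite invr_gt0.
apply: (@le_trans _ _ (\int[mu]_(r in `[h, (2 * h)%R])
    (2^-1 / (2 * h) `^ (p + 1))%:E)%E).
  rewrite integral_cst//= lebesgue_measure_itv/= lte_fin ltr_pMl ?ltr1n//.
  rewrite -EFinB -EFinM lee_fin.
  have -> : 2 * h - h = h by ring.
  have -> : (2 * h) `^ (p + 1) = 2 `^ (p + 1) * (`|s| `^ (p + 1))^-1.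
    rewrite powRM ?(ltW h0)//; congr (_ * _).
    by rewrite -powRN /h -[_^-1]powR_inv1// -powRrM mulN1r.
  have -> : 2 `^ (- (p + 2)) = (2 `^ (p + 1))^-1 / 2 :> R.
    rewrite -powRN -[X in _ = _ * X](@powR_inv1 _ 2)// -powRD; last by rewrite pnatr_eq0 implybT.
    by congr (_ `^ _); ring.
  have -> : `|s| `^ p = `|s| `^ (p + 1) * h.
    rewrite /h -[_^-1]powR_inv1// -powRD; last by rewrite (gt_eqF s0) implybT.
    by rewrite addrK.
  rewrite le_eqVlt; apply/orP; left; apply/eqP; field.
  by rewrite !gt_eqF// powR_gt0.
apply: (@le_trans _ _ (\int[mu]_(r in `[h, (2 * h)%R]) (psat (r * s) / r `^ (p + 1))%:E)%E).
  apply: integral_le_ge0 => [r|r _]; last exact: f0.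
  rewrite /= in_itv/= => /andP[r1 r2].
  have r0 : 0 < r by exact: lt_le_trans r1.
  rewrite lee_fin ler_pM ?invr_ge0 ?powR_ge0//; last first.
    rewrite lef_pV2 ?posrE ?powR_gt0 ?mulr_gt0//.
    by apply: ge0_ler_powR; rewrite ?nnegrE ?(ltW r0) ?mulr_ge0 ?(ltW h0)//; lra.
  have : 1 <= (r * s) ^+ 2.
    rewrite -(real_normK (num_real (r * s))) normrM (gtr0_norm r0).
    by rewrite exprn_ege1// -ler_pdivrMr// mul1r.
  rewrite /psat; move: (_ ^+ 2) => x x1.
  rewrite ler_pdivlMr; lra.
apply: ge0_subset_integral => //; first exact: measurable_funTS.
by move=> r /=; rewrite !in_itv/= andbT => /andP[/(lt_le_trans h0)].
Qed.

End PowerIntegrals.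

(** * Tail bounds and the mean inequality for the whole product *)

Section GenusOneProduct.
Variables (R : realType) (c : nat -> R[i]).
Hypothesis sum_c : (\sum_(k <oo) (cmod (c k) ^+ 2)%:E < +oo)%E.
Let mu := @lebesgue_measure R.
Local Open Scope complex_scope.

Let partial n (w : R[i]) : R[i] := \prod_(0 <= k < n) E1 (w * c k).

Definition sq_tail n : R := fine (\sum_(n <= k <oo) (cmod (c k) ^+ 2)%:E)%E.

Let sq_tail_fin n : (\sum_(n <= k <oo) (cmod (c k) ^+ 2)%:E)%E \is a fin_num.
Proof.
rewrite ge0_fin_numE; last by apply: nneseries_ge0 => k _ _; rewrite lee_fin sqr_ge0.
apply: le_lt_trans sum_c; rewrite (@nneseries_split _ (fun k => (cmod (c k) ^+ 2)%:E) 0 n).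
  by rewrite add0n leeDr// sume_ge0// => k _; rewrite lee_fin sqr_ge0.
by move=> k _; rewrite lee_fin sqr_ge0.
Qed.

Lemma sq_tail_ge0 n : 0 <= sq_tail n.
Proof.
rewrite fine_ge0//; apply: nneseries_ge0 => k _ _; rewrite lee_fin sqr_ge0//.
Qed.

Lemma sum_le_sq_tail n m : \sum_(n <= k < m) cmod (c k) ^+ 2 <= sq_tail n.
Proof.
rewrite -lee_fin /sq_tail fineK// -sumEFin.
by apply: nneseries_lim_ge => k _ _; rewrite lee_fin sqr_ge0.
Qed.

Lemma sq_tail_cvg : sq_tail n @[n --> \oo] --> (0 : R).
Proof.
apply: (@fine_cvg _ _ _ _ (fun n => \sum_(n <= k <oo) (cmod (c k) ^+ 2)%:E)%E).
apply: (@nneseries_tail_cvg _ (fun k => (cmod (c k) ^+ 2)%:E) xpredT sum_c).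
by move=> k _; rewrite lee_fin sqr_ge0.
Qed.

Lemma cmod_prod (F : nat -> R[i]) n m :
  cmod (\prod_(n <= k < m) F k) = \prod_(n <= k < m) cmod (F k).
Proof. by apply: (big_morph _ (@cmodM R)); exact: cmod1. Qed.

Lemma cmod_prod_E1_le (f : nat -> R) n m w :
  (forall k, cmod (E1 (w * c k)) <= expR (f k)) ->
  cmod (\prod_(n <= k < m) E1 (w * c k)) <= expR (\sum_(n <= k < m) f k).
Proof.
move=> hf; rewrite cmod_prod expR_sum; apply: ler_prod => k _.
by rewrite cmod_ge0 hf.
Qed.

Lemma cmod_partial_tail n m w : (n <= m)%N ->
  cmod (partial m w) <= cmod (partial n w) * expR (cmod w ^+ 2 / 2 * sq_tail n).
Proof.
move=> nm; rewrite /partial (big_cat_nat (leq0n n) nm)/= cmodM.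
rewrite ler_wpM2l ?cmod_ge0//.
apply: (le_trans (@cmod_prod_E1_le (fun k => cmod w ^+ 2 / 2 * cmod (c k) ^+ 2) _ _ _ _)).
  move=> k; rewrite (le_trans (cmod_E1_le_sqr _))// ler_expR cmodM exprMn.
  by rewrite mulrAC.
by rewrite ler_expR -mulr_sumr ler_wpM2l ?sum_le_sq_tail// divr_ge0 ?sqr_ge0.
Qed.

Definition genus1_lim w : R[i] := lim ((partial^~ w : nat -> (R[i])^o) @ \oo).

Lemma cmod_genus1_lim_le n w :
  cmod (genus1_lim w) <= cmod (partial n w) * expR (cmod w ^+ 2 / 2 * sq_tail n).
Proof.
apply: (@cmod_lim_le _ _ n); first by rewrite mulr_ge0 ?cmod_ge0 ?expR_ge0.
by move=> m nm; exact: cmod_partial_tail.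
Qed.

Lemma ln_max_modulus_le (r : R) : 0 <= r ->
  ((ln (max_modulus r genus1_lim))%:E <=
   \sum_(k <oo) (2 * qmin (r * cmod (c k)))%:E)%E.
Proof.
move=> r0.
have q0 k : (0 <= (2 * qmin (r * cmod (c k)))%:E)%E.
  by rewrite lee_fin mulr_ge0 ?qmin_ge0.
set S := (\sum_(k <oo) _)%E.
have [->|Sy] := eqVneq S +oo%E; first by rewrite leey.
have Sfin : S \is a fin_num.
  by rewrite ge0_fin_numE ?ltey//; apply: nneseries_ge0 => k _ _.
have S0 : 0 <= fine S by rewrite fine_ge0//; apply: nneseries_ge0 => k _ _.
have Sn n : \sum_(0 <= k < n) 2 * qmin (r * cmod (c k)) <= fine S.
  rewrite -lee_fin fineK// -sumEFin.
  by apply: nneseries_lim_ge => k _ _.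
rewrite -(fineK Sfin) lee_fin.
have le_sup : max_modulus r genus1_lim <= expR (fine S).
  apply: ge_sup.
    have hr : cmod r%:C = r by rewrite cmod_real ger0_norm.
    by exists (cmod (genus1_lim r%:C)); exact: (ex_intro2 _ _ r%:C hr erefl).
  move=> _ [w /= wr <-]; apply: (@cmod_lim_le _ _ 0); first exact: expR_ge0.
  move=> m _; apply: le_trans (@cmod_prod_E1_le _ _ _ _ (fun k => cmod_E1_le (w * c k))) _.
  rewrite ler_expR (le_trans _ (Sn m))// ler_sum// => k _.
  by rewrite cmodM wr.
(* [ln] is 0 on nonpositive reals, so this case asks only for [0 <= fine S]. *)
have [M0|M0] := leP (max_modulus r genus1_lim) 0.
  by rewrite ln0.
by rewrite -(expRK (fine S)) ler_ln// posrE expR_gt0.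
Qed.

(** log^- of the upper bound in [cmod_genus1_lim_le]: the first n factors are kept exactly, the
    others become a Gaussian. *)
Let lower n (t : R) : \bar R :=
  log_minus (cmod (partial n t%:C) * expR (t ^+ 2 / 2 * sq_tail n)).

(* A measurable minorant of [log_minus |genus1_lim t|]; working with it avoids
   proving that the product converges. *)
Definition log_minus_sup (t : R) : \bar R := esups (lower^~ t) 0.

Lemma le_log_minus (x y : R) : x <= y -> (log_minus y <= log_minus x)%E.
Proof.
move=> xy; rewrite /log_minus ge_max !le_max lexx orbT andbT.
have [x0|x0] := leP x 0; first by rewrite (le0_lneNy (x := x%:E)) ?lee_fin// leey.
by rewrite !lne_EFin ?(lt_le_trans x0)// leeN2 lee_fin ler_ln ?posrE ?(lt_le_trans x0)// xy.
Qed.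

Lemma log_minus_ge (x y : R) : x <= expR y -> ((- y)%:E <= log_minus x)%E.
Proof.
move=> /le_log_minus; apply: le_trans.
by rewrite /log_minus lne_EFin ?expR_gt0// expRK le_max lexx.
Qed.

Lemma log_minus_ge0 (x : R) : (0 <= log_minus x)%E.
Proof. by rewrite /log_minus le_max lexx orbT. Qed.

Lemma measurable_log_minus : measurable_fun [set: R] (@log_minus R).
Proof.
apply: measurable_maxe => //; apply: measurableT_comp => //.
rewrite (_ : (fun x : R => lne x%:E) =
  (fun x => if x <= 0 then -oo%E else (ln x)%:E)) //.
apply: measurable_fun_ifT => //.
  exact: measurable_fun_ler.
by apply/measurable_EFinP; exact: measurable_ln.
Qed.

Let cmod_partial_real n t : cmod (partial n t%:C) =
  \prod_(0 <= k < n) (Num.sqrt (quad (complex.Re (c k)) (complex.Im (c k)) t) *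
    expR (t * complex.Re (c k))).
Proof.
rewrite /partial cmod_prod; apply: eq_bigr => k _; rewrite cmod_E1.
by case: (c k) => x y /=; rewrite !mul0r subr0 addr0.
Qed.

Lemma measurable_log_minus_sup : measurable_fun [set: R] log_minus_sup.
Proof.
apply: measurable_fun_esups => n.
apply: (measurableT_comp measurable_log_minus).
apply: measurable_funM; last first.
  apply: (measurableT_comp (@measurable_expR R)).
  by do 2 apply: measurable_funM => //; exact: measurable_funX.
under eq_fun do rewrite cmod_partial_real.
elim: n => [|n IHn].
  rewrite (_ : (fun _ => _) = cst 1); first exact: measurable_cst.
  by apply/funext => t; rewrite big_geq.
under eq_fun do rewrite big_nat_recr//=.
apply: measurable_funM => //; apply: measurable_funM.
  apply: (measurableT_comp (continuous_measurable_fun (@sqrt_continuous R))).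
  apply: measurable_funD; apply: measurable_funX; last exact: measurable_funM.
  by apply: measurable_funB => //; exact: measurable_funM.
by apply: (measurableT_comp (@measurable_expR R)); exact: measurable_funM.
Qed.

Lemma log_minus_sup_ge0 t : (0 <= log_minus_sup t)%E.
Proof.
apply: le_trans (log_minus_ge0 _) _; apply: ereal_sup_ubound; exists 0%N => //.
Qed.

Lemma log_minus_sup_le t : (log_minus_sup t <= log_minus (cmod (genus1_lim t%:C)))%E.
Proof.
apply: ge_ereal_sup => _ [n _ <-]; apply: le_log_minus.
by rewrite (le_trans (cmod_genus1_lim_le n _))// cmod_real real_normK ?num_real.
Qed.

Lemma sum_psat_le (tau : R) : 0 < tau ->
  (\sum_(k <oo) (pi / 100 * psat (tau * complex.Re (c k)))%:E <=
   \sum_(k <oo) (20 * pi * qmin (tau * complex.Im (c k)))%:E +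
   \int[mu]_t (log_minus_sup t * (kern (t / tau) / tau)%:E))%E.
Proof.
move=> tau0; set I := (\int[mu]_t _)%E; set S := (\sum_(k <oo) (20 * _ * _)%:E)%E.
have p0 k : (0 <= (pi / 100 * psat (tau * complex.Re (c k)))%:E)%E.
  by rewrite lee_fin mulr_ge0 ?psat_ge0// divr_ge0 ?pi_ge0.
have q0 k : (0 <= (20 * pi * qmin (tau * complex.Im (c k)))%:E)%E.
  by rewrite lee_fin mulr_ge0 ?qmin_ge0// mulr_ge0 ?pi_ge0.
apply: lime_le; first by apply: is_cvg_nneseries => k _ _.
apply: nearW => m; apply/lee_addgt0Pr => e e0.
(* The truncation m of the left-hand sum stays fixed while n grows until the tail costs at most [e];
   the [psat] terms from m to n are nonnegative and are dropped later. *)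
have [n [mn hn]] : exists n, (m <= n)%N /\ 3 * pi * (sq_tail n / 2) * tau ^+ 2 <= e.
  have C0 : 0 < 3 * pi * tau ^+ 2 :> R by rewrite !mulr_gt0 ?pi_gt0 ?exprn_gt0.
  have /cvgrPdist_le /(_ _ (divr_gt0 e0 C0)) [n0 _ hn0] := sq_tail_cvg.
  exists (maxn n0 m); split; first exact: leq_maxr.
  have /= := hn0 (maxn n0 m) (leq_maxl _ _).
  rewrite sub0r normrN ger0_norm ?sq_tail_ge0// ler_pdivlMr// => h.
  have := sq_tail_ge0 (maxn n0 m); have := mulr_ge0 (sq_tail_ge0 (maxn n0 m)) (ltW C0); lra.
have tail0 : 0 <= sq_tail n / 2 by rewrite divr_ge0 ?sq_tail_ge0.
have hu (B : 'I_n -> R) t :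
    (forall k : 'I_n, `|complex.Im (c k)| <= B k /\ 0 < quad (complex.Re (c k)) (B k) t) ->
    ((- \sum_(k < n) (ln (quad (complex.Re (c k)) (B k) t) / 2 + t * complex.Re (c k))
       - sq_tail n / 2 * t ^+ 2)%:E <= log_minus_sup t)%E.
  move=> hB; apply: (@le_trans _ _ (lower n t)); last first.
    by apply: ereal_sup_ubound; exists n.
  rewrite -opprD; apply: log_minus_ge.
  have -> : t ^+ 2 / 2 * sq_tail n = sq_tail n / 2 * t ^+ 2 by ring.
  rewrite expRD ler_pM2r ?expR_gt0// cmod_partial_real big_mkord expR_sum.
  apply: ler_prod => k _; rewrite mulr_ge0 ?sqrtr_ge0 ?expR_ge0//=.
  have [bB q0'] := hB k.
  rewrite expRD ler_pM2r ?expR_gt0//.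
  (* Raising |Im c_k| to [B k] enlarges the factor; [quad] is then positive, and its square root is
     the exponential of half its logarithm. *)
  apply: (@le_trans _ _ (Num.sqrt (quad (complex.Re (c k)) (B k) t))).
    rewrite ler_wsqrtr// /quad lerD2l !exprMn ler_wpM2l ?sqr_ge0//.
    by rewrite -(real_normK (num_real (complex.Im _))) lerXn2r ?nnegrE// (le_trans _ bB).
  rewrite -[leRHS]gtr0_norm ?expR_gt0// -sqrtr_sqr ler_wsqrtr// -expRM_natl.
  by rewrite mulrC divfK// lnK.
have := log_product_mean tail0 tau0 measurable_log_minus_sup log_minus_sup_ge0 hu.
rewrite -/I => hI.
apply: (@le_trans _ _ ((\sum_(0 <= k < n) (20 * pi * qmin (tau * complex.Im (c k))))%:E + I + e%:E)%E);
  last first.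
  rewrite leeD2r// leeD2r// -sumEFin.
  by apply: nneseries_lim_ge => k _ _.
apply: (@le_trans _ _ (((\sum_(0 <= k < n) (20 * pi * qmin (tau * complex.Im (c k)))) +
  (\sum_(k < n) pi * (1 / 100 * psat (tau * complex.Re (c k)) - 20 * qmin (tau * complex.Im (c k)))
     - 3 * pi * (sq_tail n / 2) * tau ^+ 2) + e)%:E)).
  rewrite sumEFin lee_fin.
  apply: (@le_trans _ _ (\sum_(0 <= k < n) (pi / 100 * psat (tau * complex.Re (c k))))).
    rewrite [leRHS](big_cat_nat (leq0n m) mn)/= lerDl sumr_ge0// => k _.
    by rewrite -lee_fin.
  have -> : \sum_(k < n) pi * (1 / 100 * psat (tau * complex.Re (c k)) - 20 * qmin (tau * complex.Im (c k)))
    = \sum_(0 <= k < n) (pi / 100 * psat (tau * complex.Re (c k))) -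
      \sum_(0 <= k < n) (20 * pi * qmin (tau * complex.Im (c k))).
    by rewrite !big_mkord -sumrB; apply: eq_bigr => k _; ring.
  lra.
rewrite EFinD leeD2r// EFinD leeD2l//.
Qed.

End GenusOneProduct.

(** * Integration over the scales [tau] *)

Section MarcinkiewiczInequality.
Variables (R : realType) (p : R).
Hypothesis p12 : 1 < p < 2.
Let mu := @lebesgue_measure R.
Let wgt (t : R) : R := (t `^ (p + 1))^-1.

Let wgt_ge0 t : 0 <= wgt t.
Proof. by rewrite invr_ge0 powR_ge0. Qed.

Let measurable_wgt : measurable_fun [set: R] wgt.
Proof. by apply: (measurableT_comp (@measurable_invr R)); exact: measurable_powR. Qed.

(** The pair is (tau, t). The indicator keeps the function nonnegative on the whole plane, where
    Tonelli's theorem is applied. *)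
Let dens (u : R -> \bar R) (x : R * R) : \bar R :=
  (u x.2 * (kern (x.2 / x.1) / x.1 * wgt x.1 * \1_(`]0, +oo[%classic : set R) x.1)%:E)%E.

Let dens_ge0 u : (forall t, 0 <= u t)%E -> forall x, (0 <= dens u x)%E.
Proof.
move=> u0 [tau t]; rewrite /dens/=; have [t0|t0] := ltP 0 tau.
  rewrite mule_ge0// lee_fin mulr_ge0 ?indicE ?ler0n// mulr_ge0//.
  by rewrite divr_ge0 ?kern_ge0 ?ltW.
rewrite indicE memNset ?mulr0 ?mule0//= in_itv/= andbT => /lt_geF.
by rewrite t0.
Qed.

Let measurable_dens u : measurable_fun [set: R] u ->
  measurable_fun [set: R * R] (dens u).
Proof.
move=> mu_; apply: emeasurable_funM; first exact: (measurableT_comp mu_).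
apply/measurable_EFinP; apply: measurable_funM; last first.
  by apply: (measurableT_comp (measurable_indic _)) => //.
apply: measurable_funM; last exact: (measurableT_comp measurable_wgt).
have minv : measurable_fun [set: R * R] (fun x => x.1^-1).
  by apply: (measurableT_comp (@measurable_invr R)).
apply: measurable_funM => //; apply: (measurableT_comp (@measurable_kern R)).
exact: measurable_funM.
Qed.

(** After exchanging the integrals, [kern_scale_le] and [integral_qmin_le] at s = 1/t bound the
    integral over tau by 3 [qmin_const p] |t|^(-p-1), the weight in [alpha_inv]. *)
Let integral_dens_le u : measurable_fun [set: R] u ->
    (forall t, 0 <= u t)%E ->
  (\int[mu]_tau \int[mu]_t dens u (tau, t) <=
   (3 * qmin_const p)%:E * \int[mu]_t (u t * (wgt `|t|)%:E))%E.
Proof.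
move=> mu_ u0; have /andP[p1 p2] := p12.
have C0 : 0 <= 3 * qmin_const p.
  by rewrite mulr_ge0// addr_ge0// invr_ge0 subr_ge0 ltW.
rewrite (@fubini_tonelli _ _ (measurableTypeR R) (measurableTypeR R) R
  lebesgue_measure lebesgue_measure (dens u) (measurable_dens mu_) (dens_ge0 u0)).
rewrite -ge0_integralZl//; last 2 first.
- apply: emeasurable_funM => //; apply/measurable_EFinP.
  by apply: (measurableT_comp measurable_wgt); exact: normr_measurable.
- by move=> t _; rewrite mule_ge0// lee_fin wgt_ge0.
apply: integral_le_ge0 => t _; last by rewrite !mule_ge0// lee_fin wgt_ge0.
have mk : measurable_fun [set: R] (fun tau => kern (t / tau) / tau * wgt tau).
  apply: measurable_funM => //; apply: measurable_funM; last exact: measurable_invr.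
  apply: (measurableT_comp (@measurable_kern R)); apply: measurable_funM => //.
  exact: measurable_invr.
have k0 tau : `]0, +oo[%classic tau -> (0 <= (kern (t / tau) / tau * wgt tau)%:E)%E.
  rewrite /= in_itv/= andbT => tau0.
  by rewrite lee_fin mulr_ge0 ?wgt_ge0// divr_ge0 ?kern_ge0 ?ltW.
have -> : (\int[mu]_tau dens u (tau, t) =
    u t * \int[mu]_(tau in `]0%R, +oo[) (kern (t / tau) / tau * wgt tau)%:E)%E.
  rewrite -ge0_integralZl//; last exact/measurable_EFinP/measurable_funTS.
  rewrite [RHS]integral_mkcond; apply: eq_integral => tau _.
  rewrite /dens /= patchE indicE; case: ifPn => _; first by rewrite mulr1.
  by rewrite mulr0 mule0.
rewrite muleCA; apply: lee_wpmul2l => //.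
have [->|t0] := eqVneq t 0.
  rewrite normr0 /wgt powR0 ?invr0 ?mule0; last by rewrite gt_eqF//; lra.
  by rewrite integral0_eq// => tau _; rewrite mul0r /kern mul0r expr0n invr0 mulr0 !mul0r.
have tn : 0 < `|t| by rewrite normr_gt0.
apply: (@le_trans _ _ (\int[mu]_(tau in `]0%R, +oo[)
    ((3 / `|t|)%:E * (qmin (tau * t^-1) / tau `^ (p + 1))%:E))%E).
  apply: integral_le_ge0 => tau; rewrite /= in_itv/= andbT => tau0.
    by rewrite -EFinM lee_fin mulrA ler_wpM2r ?wgt_ge0// kern_scale_le.
  by rewrite -EFinM lee_fin !mulr_ge0 ?qmin_ge0 ?invr_ge0 ?powR_ge0.
rewrite ge0_integralZl//; last 2 first.
- apply/measurable_EFinP/measurable_funTS; apply: measurable_funM => //.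
  by apply: (measurableT_comp (@measurable_qmin R)); exact: measurable_funM.
- by move=> tau _; rewrite lee_fin mulr_ge0 ?qmin_ge0 ?invr_ge0 ?powR_ge0.
apply: (le_trans (lee_wpmul2l _ (integral_qmin_le t^-1 p12))).
  by rewrite lee_fin divr_ge0.
rewrite -!EFinM lee_fin /wgt.
have -> : `|t^-1| `^ p = (`|t| `^ p)^-1.
  by rewrite normfV -[_^-1]powR_inv1// -powRrM mulN1r powRN.
rewrite powRD ?(gt_eqF tn) ?implybT// powRr1//.
rewrite le_eqVlt; apply/orP; left; apply/eqP; field.
by rewrite !gt_eqF ?powR_gt0.
Qed.

Section Sequence.
Variable c : nat -> R[i].
Hypothesis sum_c : (\sum_(k <oo) (cmod (c k) ^+ 2)%:E < +oo)%E.

(** Serves twice: for the imaginary parts with A = 20 pi, and for the moduli with A = 2. *)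
Let integral_qmin_series_le (A : R) (x : nat -> R) : 0 <= A ->
  (\int[mu]_(r in `]0%R, +oo[) (\sum_(k <oo) (A * qmin (r * x k) * wgt r)%:E) <=
   \sum_(k <oo) (A * qmin_const p * `|x k| `^ p)%:E)%E.
Proof.
move=> A0.
have mq k : measurable_fun [set: R] (fun r => qmin (r * x k) * wgt r).
  apply: measurable_funM => //.
  by apply: (measurableT_comp (@measurable_qmin R)); exact: measurable_funM.
rewrite integral_nneseries//; last 2 first.
- move=> k; apply/measurable_EFinP/measurable_funTS.
  by under eq_fun do rewrite -mulrA; apply: measurable_funM => //; exact: mq.
- by move=> k r _; rewrite lee_fin mulr_ge0 ?wgt_ge0// mulr_ge0 ?qmin_ge0.
apply: lee_nneseries => [k _ _|k _].
  by apply: integral_ge0 => r _; rewrite lee_fin mulr_ge0 ?wgt_ge0// mulr_ge0 ?qmin_ge0.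
under eq_integral do rewrite -mulrA EFinM.
rewrite ge0_integralZl//.
- rewrite -mulrA EFinM; apply: lee_wpmul2l; first by rewrite lee_fin.
  exact: (integral_qmin_le _ p12).
- apply/measurable_EFinP/measurable_funTS; exact: (mq k).
- by move=> r _; rewrite lee_fin mulr_ge0 ?qmin_ge0 ?wgt_ge0.
Qed.

(** The coefficient of [psat] in [sum_psat_le] times the constant of [integral_psat_ge]. *)
Definition psat_const : R := pi / 100 * 2 `^ (- (p + 2)).

Lemma sum_Re_le :
  (\sum_(k <oo) (psat_const * `|complex.Re (c k)| `^ p)%:E <=
   \sum_(k <oo) (20 * pi * qmin_const p * `|complex.Im (c k)| `^ p)%:E +
   (3 * qmin_const p * pi)%:E * alpha_inv p (genus1_lim c))%E.
Proof.
have /andP[p1 p2] := p12.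
have p0 : 0 < p by rewrite (lt_trans _ p1).
set u := log_minus_sup c.
have mu_ : measurable_fun [set: R] u := measurable_log_minus_sup c.
have u0 t : (0 <= u t)%E := log_minus_sup_ge0 c t.
pose a k := complex.Re (c k); pose b k := complex.Im (c k).
pose J tau := (\int[mu]_t dens u (tau, t))%E.
have mJ : measurable_fun [set: R] J.
  exact: (@measurable_fun_fubini_tonelli_F _ _ (measurableTypeR R) (measurableTypeR R) R
    lebesgue_measure (dens u) (measurable_dens mu_) (dens_ge0 u0)).
have J0 tau : (0 <= J tau)%E by apply: integral_ge0 => t _; exact: dens_ge0.
have JE tau : 0 < tau ->
    J tau = ((\int[mu]_t (u t * (kern (t / tau) / tau)%:E)) * (wgt tau)%:E)%E.
  move=> tau0; rewrite -ge0_integralZr//.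
  - apply: eq_integral => t _; rewrite /dens/= indicE mem_set ?mulr1//= ?in_itv/= ?andbT//.
    by rewrite EFinM muleA.
  - apply: emeasurable_funM => //; apply/measurable_EFinP.
    apply: measurable_funM => //; apply: (measurableT_comp (@measurable_kern R)).
    exact: measurable_funM.
  - by move=> t _; rewrite mule_ge0// lee_fin divr_ge0 ?kern_ge0 ?ltW.
  - by rewrite lee_fin.
have pi0 : 0 <= pi / 100 :> R by rewrite divr_ge0 ?pi_ge0.
have pi1 : 0 <= 20 * pi :> R by rewrite mulr_ge0 ?pi_ge0.
have step tau : `]0, +oo[%classic tau ->
    (\sum_(k <oo) (pi / 100 * psat (tau * a k) * wgt tau)%:E <=
     \sum_(k <oo) (20 * pi * qmin (tau * b k) * wgt tau)%:E + J tau)%E.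
  rewrite /= in_itv/= andbT => tau0; rewrite JE//.
  have Zr (f : nat -> R) : (forall k, 0 <= f k) ->
      (\sum_(k <oo) (f k * wgt tau)%:E = (\sum_(k <oo) (f k)%:E) * (wgt tau)%:E)%E.
    move=> f0; rewrite muleC -nneseriesZl; last by move=> k _; rewrite lee_fin.
    by apply: eq_eseriesr => k _; rewrite -EFinM mulrC.
  rewrite !Zr; last 2 first.
  - by move=> k; rewrite mulr_ge0 ?qmin_ge0 ?wgt_ge0.
  - by move=> k; rewrite mulr_ge0 ?psat_ge0 ?wgt_ge0.
  rewrite -ge0_muleDl.
  - by apply: lee_wpmul2r; rewrite ?lee_fin//; exact: sum_psat_le.
  - by apply: nneseries_ge0 => k _ _; rewrite lee_fin mulr_ge0 ?qmin_ge0 ?wgt_ge0.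
  - apply: integral_ge0 => t _.
    by rewrite mule_ge0// lee_fin divr_ge0 ?kern_ge0 ?ltW.
apply: (@le_trans _ _ (\int[mu]_(tau in `]0%R, +oo[)
   \sum_(k <oo) (pi / 100 * psat (tau * a k) * wgt tau)%:E)%E).
  rewrite integral_nneseries//; last 2 first.
  - move=> k; apply/measurable_EFinP/measurable_funTS; apply: measurable_funM => //.
    apply: measurable_funM => //; apply: (measurableT_comp (@measurable_psat R)).
    exact: measurable_funM.
  - by move=> k tau _; rewrite lee_fin mulr_ge0 ?wgt_ge0// mulr_ge0 ?psat_ge0.
  apply: lee_nneseries => [k _ _|k _].
    by rewrite lee_fin mulr_ge0 ?powR_ge0// mulr_ge0 ?powR_ge0.
  apply: (@le_trans _ _ ((pi / 100)%:E * (2 `^ (- (p + 2)) * `|a k| `^ p)%:E)%E).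
    by rewrite -EFinM lee_fin /psat_const mulrA.
  apply: (le_trans (lee_wpmul2l _ (integral_psat_ge (a k) p0))) => //.
  rewrite -ge0_integralZl//.
  - apply: integral_le_ge0 => tau _; first by rewrite -EFinM lee_fin mulrA.
    by rewrite lee_fin mulr_ge0 ?wgt_ge0// mulr_ge0 ?psat_ge0.
  - apply/measurable_EFinP/measurable_funTS; apply: measurable_funM => //.
    apply: (measurableT_comp (@measurable_psat R)); exact: measurable_funM.
  - by move=> tau _; rewrite lee_fin mulr_ge0 ?psat_ge0 ?wgt_ge0.
have mq : measurable_fun [set: R]
    (fun tau => \sum_(k <oo) (20 * pi * qmin (tau * b k) * wgt tau)%:E)%E.
  apply: ge0_emeasurable_sum.
    by move=> k tau _ _; rewrite lee_fin mulr_ge0 ?wgt_ge0// mulr_ge0 ?qmin_ge0.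
  move=> k _; apply/measurable_EFinP; apply: measurable_funM => //.
  apply: measurable_funM => //; apply: (measurableT_comp (@measurable_qmin R)).
  exact: measurable_funM.
have q0 tau : (0 <= \sum_(k <oo) (20 * pi * qmin (tau * b k) * wgt tau)%:E)%E.
  by apply: nneseries_ge0 => k _ _; rewrite lee_fin mulr_ge0 ?wgt_ge0// mulr_ge0 ?qmin_ge0.
apply: (@le_trans _ _ (\int[mu]_(tau in `]0%R, +oo[)
   (\sum_(k <oo) (20 * pi * qmin (tau * b k) * wgt tau)%:E + J tau))%E).
  by apply: integral_le_ge0 => tau; [exact: step|rewrite adde_ge0].
rewrite ge0_integralD//; last 2 first.
- exact: measurable_funTS.
- exact: measurable_funTS.
apply: leeD; first exact: integral_qmin_series_le.
apply: (@le_trans _ _ (\int[mu]_tau J tau)%E).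
  by apply: ge0_subset_integral => //; exact: measurable_funTS.
apply: (le_trans (integral_dens_le mu_ u0)).
rewrite (EFinM (3 * qmin_const p) pi) -muleA; apply: lee_wpmul2l.
  by rewrite lee_fin mulr_ge0// addr_ge0// invr_ge0 subr_ge0 ltW.
(* The pi in the constant cancels the 1/pi of [alpha_inv]. Only now is the measurable minorant
   exchanged for log^-|Pi| itself, by a comparison of integrals free of measurability conditions. *)
rewrite /alpha_inv muleA -EFinM divff ?mul1e; last by rewrite gt_eqF ?pi_gt0.
apply: integral_le_ge0 => t _; last by rewrite mule_ge0 ?log_minus_ge0 ?lee_fin.
by apply: lee_wpmul2r; rewrite ?lee_fin//; exact: log_minus_sup_le.
Qed.

Lemma integral_ln_max_modulus_le :
  (\int[mu]_(r in `]0%R, +oo[)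
     (ln (max_modulus r (genus1_lim c)) / r `^ (p + 1))%:E <=
   \sum_(k <oo) (2 * qmin_const p * `|cmod (c k)| `^ p)%:E)%E.
Proof.
apply: (@le_trans _ _ (\int[mu]_(r in `]0%R, +oo[)
   (\sum_(k <oo) (2 * qmin (r * cmod (c k)) * wgt r)%:E))%E).
  apply: integral_le_ge0 => r; rewrite /= in_itv/= andbT => r0; last first.
    by apply: nneseries_ge0 => k _ _; rewrite lee_fin mulr_ge0 ?wgt_ge0// mulr_ge0 ?qmin_ge0.
  rewrite EFinM; apply: (@le_trans _ _
      ((\sum_(k <oo) (2 * qmin (r * cmod (c k)))%:E) * (wgt r)%:E)%E).
    apply: lee_wpmul2r; first by rewrite lee_fin wgt_ge0.
    by apply: ln_max_modulus_le => //; exact: ltW.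
  rewrite muleC -nneseriesZl; last by move=> k _; rewrite lee_fin mulr_ge0 ?qmin_ge0 ?wgt_ge0.
  apply: lee_nneseries => [k _ _|k _]; rewrite -EFinM lee_fin; last by rewrite mulrC.
  by rewrite mulr_ge0 ?wgt_ge0// mulr_ge0 ?qmin_ge0.
exact: integral_qmin_series_le.
Qed.

End Sequence.

End MarcinkiewiczInequality.

(** * From real and imaginary parts to the final constant *)

Lemma cmod_powR_le (R : realType) (p : R) (w : R[i]) : 0 <= p <= 2 ->
  `|cmod w| `^ p <= 4 * (`|complex.Re w| `^ p + `|complex.Im w| `^ p).
Proof.
move=> /andP[p0 p2]; rewrite ger0_norm ?cmod_ge0//.
pose m := Num.max `|complex.Re w| `|complex.Im w|.
have m0 : 0 <= m by rewrite le_max normr_ge0.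
have wm : cmod w <= 2 * m.
  rewrite -[leRHS]ger0_norm ?mulr_ge0// -sqrtr_sqr cmodRI ler_wsqrtr//.
  have sq (x : R) : `|x| <= m -> x ^+ 2 <= m ^+ 2.
    by move=> xm; rewrite -(real_normK (num_real x)) lerXn2r ?nnegrE.
  have := sq _ (_ : `|complex.Re w| <= m); rewrite le_max lexx => /(_ isT).
  have := sq _ (_ : `|complex.Im w| <= m); rewrite le_max lexx orbT => /(_ isT).
  have := sqr_ge0 m; rewrite exprMn; lra.
apply: (@le_trans _ _ ((2 * m) `^ p)).
  by apply: ge0_ler_powR; rewrite ?nnegrE ?cmod_ge0 ?mulr_ge0.
rewrite powRM// ler_pM ?powR_ge0//.
  apply: (@le_trans _ _ (2 `^ 2%:R)); first by rewrite ler_powR// ler1n.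
  by rewrite powR_mulrn// -natrX.
rewrite /m /Num.max; case: ifPn => _; first by rewrite lerDr powR_ge0.
by rewrite lerDl powR_ge0.
Qed.

Theorem theorem5 (R : realType) (p : R) (hp1 : 1 < p) (hp2 : p < 2) :
  exists K : R, 0 < K /\
    forall (N : option nat) (z : nat -> R[i]), genus1_zeros N z ->
      (\int[@lebesgue_measure R]_(r in `]0%R, +oo[%classic)
         (ln (max_modulus r (canonical_product N z)) / r `^ (p + 1))%:E
       <= K%:E * (gamma p N z + alpha_inv p (canonical_product N z)))%E.
Proof.
have p12 : 1 < p < 2 by rewrite hp1.
have q0 : 0 < qmin_const p by rewrite addr_gt0// invr_gt0 subr_gt0.
have s0 : 0 < psat_const p by rewrite mulr_gt0 ?powR_gt0// divr_gt0 ?pi_gt0.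
have pi0 : 0 < pi :> R := pi_gt0 R.
(* The ratio of constants in [sum_Re_le]; 20 also dominates the 3 in front of [alpha_inv]. *)
pose A := 20 * pi * qmin_const p / psat_const p.
have A0 : 0 < A by rewrite divr_gt0 ?mulr_gt0.
(* 8 = 2 * 4, from [cmod_E1_le] and [cmod_powR_le]; the 1 accounts for the imaginary parts of the
   c_k themselves. *)
exists (8 * qmin_const p * (A + 1)); split.
  by rewrite !mulr_gt0// addr_gt0.
move=> N z [_ sum_z].
(* Padding by 0 makes every sequence infinite: [E1 0] is 1, and a zero term adds nothing to any of
   the sums, as p > 0. *)
pose c k := if in_range N k then (z k)^-1 else 0.
have lim_c : canonical_product N z = genus1_lim c.
  apply/funext => w; rewrite /canonical_product /genus1_lim.
  have -> // : (fun n => \prod_(0 <= k < n | in_range N k) E1 (w / z k)) =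
    (fun n => \prod_(0 <= k < n) E1 (w * c k)).
  apply/funext => n; rewrite big_mkcond; apply: eq_bigr => k _; rewrite /c.
  case: ifPn => // _; rewrite mulr0 /E1 subr0 mul1r /cexp/=.
  by rewrite expR0 cos0 sin0 mulr1 mulr0.
have sum_c : (\sum_(k <oo) (cmod (c k) ^+ 2)%:E < +oo)%E.
  move: sum_z; rewrite eseries_mkcond; congr (_ < _)%E.
  apply: eq_eseriesr => k _; rewrite /c; case: ifPn => _; last by rewrite cmod0 expr0n.
  by rewrite /cmod Normc.normcV exprVn.
have gammaE : gamma p N z = (\sum_(k <oo) (`|complex.Im (c k)| `^ p)%:E)%E.
  rewrite /gamma eseries_mkcond; apply: eq_eseriesr => k _; rewrite /c.
  by case: ifPn => // _; rewrite normr0 powR0// gt_eqF// (lt_trans _ hp1).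
rewrite lim_c gammaE.
set g := (\sum_(k <oo) _)%E; set al := alpha_inv _ _.
pose a := (\sum_(k <oo) (`|complex.Re (c k)| `^ p)%:E)%E.
have g0 : (0 <= g)%E by apply: nneseries_ge0 => k _ _; rewrite lee_fin powR_ge0.
have a0 : (0 <= a)%E by apply: nneseries_ge0 => k _ _; rewrite lee_fin powR_ge0.
have al0 : (0 <= al)%E.
  rewrite mule_ge0 ?lee_fin ?invr_ge0 ?pi_ge0//; apply: integral_ge0 => t _.
  by rewrite mule_ge0 ?log_minus_ge0// lee_fin invr_ge0 powR_ge0.
have ZE (C : R) (f : nat -> R) : (forall k, 0 <= f k) ->
    (\sum_(k <oo) (C * f k)%:E = C%:E * \sum_(k <oo) (f k)%:E)%E.
  by move=> f0; rewrite -nneseriesZl// => k _; rewrite lee_fin.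
have aE : (a <= A%:E * g + A%:E * al)%E.
  have := sum_Re_le p12 sum_c.
  rewrite !ZE; [|by move=> k; rewrite powR_ge0..].
  rewrite -/a -/g -/al => h.
  (* The constant is divided out in the extended reals, since [a] may be infinite at this point. *)
  have -> : a = ((psat_const p)^-1%:E * ((psat_const p)%:E * a))%E.
    by rewrite muleA -EFinM mulVf ?mul1e// gt_eqF.
  apply: (@le_trans _ _ ((psat_const p)^-1%:E * ((20 * pi * qmin_const p)%:E * g
     + (20 * pi * qmin_const p)%:E * al))%E).
    apply: lee_wpmul2l; first by rewrite lee_fin invr_ge0 ltW.
    apply: (le_trans h); apply: leeD2l; apply: lee_wpmul2r => //.
    rewrite lee_fin; have := mulr_gt0 q0 pi0; lra.
  have C0 : 0 <= 20 * pi * qmin_const p by rewrite !mulr_ge0 ?(ltW pi0) ?(ltW q0).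
  rewrite ge0_muleDr ?(mule_ge0 _ g0) ?(mule_ge0 _ al0) ?lee_fin//.
  by rewrite !muleA -!EFinM [_^-1 * _]mulrC.
apply: (le_trans (integral_ln_max_modulus_le p12 c)).
apply: (@le_trans _ _ ((8 * qmin_const p)%:E * (a + g))%E).
  rewrite ZE; last by move=> k; rewrite powR_ge0.
  rewrite /a /g -nneseriesD//; [|by move=> k _ _; rewrite lee_fin powR_ge0..].
  rewrite -!nneseriesZl; [|by move=> k _; rewrite ?adde_ge0// lee_fin powR_ge0..].
  apply: lee_nneseries => [k _ _|k _].
    by rewrite -EFinM lee_fin !mulr_ge0 ?powR_ge0// ltW.
  rewrite -EFinD -!EFinM lee_fin.
  have := @cmod_powR_le R p (c k); rewrite (ltW (lt_trans _ hp1))// (ltW hp2).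
  move=> /(_ isT) /(ler_wpM2l (_ : 0 <= 2 * qmin_const p)).
  rewrite mulr_ge0 ?(ltW q0)// => /(_ isT) /le_trans; apply.
  by rewrite le_eqVlt; apply/orP; left; apply/eqP; ring.
rewrite (EFinM (8 * _) (A + 1)) -muleA; apply: lee_wpmul2l; first by rewrite lee_fin mulr_ge0// ltW.
apply: (le_trans (leeD2r _ aE)).
rewrite EFinD ge0_muleDl ?lee_fin ?(ltW A0)// mul1e ge0_muleDr//.
by rewrite leeD2l// leeDl.
Qed.
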